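(* Let $j\in\{0,\tfrac12,1,\tfrac32,\dots\}$, $d=2j+1$ and $S=\{-j,-j+1,-j+2,\dots,j\}$. Let $a_d(\lambda,\mu)$ be the polynomial defined by $P_dv_0=a_d(\lambda,\mu)v_{-d}$ in the density module $V_{\lambda,\mu}$, where $P_d$ is the normalized element giving the singular vector of energy $(j+1)^2$ in the Verma module $M(1,j^2)$. Then: (a) $a_d(0,\mu)=(-1)^d\prod_{k\in S}(\mu+j^2-k^2)$; (b) $a_d(1,\mu)=(-1)^d\prod_{k\in S}(\mu+j^2-(k+1)^2)$; (c) $a_d(p^2,\mu)=(-1)^d\prod_{k\in S}(\mu+j^2-(k+p)^2)$ for $p\ge0$; (d) $a_d(\lambda,\mu)^2=\prod_{k\in S}\big((\lambda-\mu-j^2+k^2)^2-4\lambda k^2\big)$.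
   Context: The Virasoro algebra has basis $L_n$ ($n\in\mathbb Z$) and central $C$, with $[L_m,L_n]=(m-n)L_{m+n}+\delta_{m+n,0}\frac{m^3-m}{12}C$. $M(c,h)$ is the Verma module generated by $v$ with $L_nv=0$ ($n>0$), $L_0v=hv$, $C=c$. For $\lambda,\mu\in\mathbb C$ the density module $V_{\lambda,\mu}$ has basis $v_n$ ($n\in\mathbb Z$), and the Virasoro algebra acts on it with $C=0$ by letting $L_k$ act as $\ell_k$, where $\ell_kv_n=-(n+\lambda k+\mu)v_{n+k}$. Let $\mathcal U_1$ be the universal enveloping algebra of the Lie algebra spanned by $L_{-k}$, $k\ge1$, and $\mathcal U_2$ that of the Lie algebra spanned by $L_{-k}$, $k\ge2$; every element of $\mathcal U_1$ is uniquely of the form $\sum_{k\ge0}q_kL_{-1}^k$ with $q_k\in\mathcal U_2$. The Verma module $M(1,j^2)$ has, up to a scalar, a unique singular vector (non-zero $L_0$-eigenvector annihilated by all $L_n$, $n>0$) of energy $j^2+d=(j+1)^2$; it is of the form $P_dv$ with $P_d=\sum_{k=0}^dq_kL_{-1}^k\in\mathcal U_1$ homogeneous of total degree $d$ (where $L_{-k}$ has degree $k$), and the scalar $q_d$ is non-zero; $P_d$ is normalized so that $q_d=1$. *)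

(* Defs.v *)
From HB Require Import structures.
From mathcomp Require Import all_boot all_order all_algebra.
From mathcomp Require Import finmap monalg boolp reals complex ring zify.

Set Implicit Arguments.
Unset Strict Implicit.
Unset Printing Implicit Defensive.

Import Order.TTheory GRing.Theory Num.Theory.
Local Open Scope ring_scope.
Local Open Scope quotient_scope.

HB.mixin Record Lmodule_isLie (K : fieldType) g of GRing.Lmodule K g := {
  lie : g -> g -> g;
  lie_linl : forall (a : K) x y z, lie (a *: x + y) z = a *: lie x z + lie y z;
  lie_linr : forall (a : K) x y z, lie x (a *: y + z) = a *: lie x y + lie x z;
  liexx : forall x, lie x x = 0;
  lie_jacobi : forall x y z,
    lie x (lie y z) + lie y (lie z x) + lie z (lie x y) = 0
}.

#[short(type="lieType")]
HB.structure Definition Lie (K : fieldType) :=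
  {g of GRing.Lmodule K g & Lmodule_isLie K g}.

Record lieHom (K : fieldType) (g g' : lieType K) := LieHom {
  lie_hom :> g -> g';
  lie_hom_lin : forall a x y, lie_hom (a *: x + y) = a *: lie_hom x + lie_hom y;
  lie_hom_lie : forall x y, lie_hom (lie x y) = lie (lie_hom x) (lie_hom y)
}.

Record lieRep (K : fieldType) (g : lieType K) (M : lmodType K) := LieRep {
  rep :> g -> M -> M;
  rep_linl : forall a x y m, rep (a *: x + y) m = a *: rep x m + rep y m;
  rep_linr : forall a x m m', rep x (a *: m + m') = a *: rep x m + rep x m';
  rep_lie : forall x y m, rep (lie x y) m = rep x (rep y m) - rep y (rep x m)
}.

Section Pullback.
Variables (K : fieldType) (g g' : lieType K) (M : lmodType K).
Variables (f : lieHom g g') (rho : lieRep g' M).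

Fact pull_linl a x y m :
  rho (f (a *: x + y)) m = a *: rho (f x) m + rho (f y) m.
Proof. by rewrite lie_hom_lin rep_linl. Qed.

Fact pull_lie x y m :
  rho (f (lie x y)) m = rho (f x) (rho (f y) m) - rho (f y) (rho (f x) m).
Proof. by rewrite lie_hom_lie rep_lie. Qed.

Definition rep_pull : lieRep g M :=
  LieRep pull_linl (fun a x => rep_linr rho a (f x)) pull_lie.
End Pullback.

(* The universal enveloping algebra of g: the unital associative K-algebra
   presented by generators x \in g, subject to linearity in x and to the relations
   x y - y x = [x, y]. It is the quotient of the type of algebra terms by the
   least congruence containing the algebra axioms and these relations. *)
Inductive uterm (K : fieldType) (g : lieType K) :=
  | UGen of g
  | UZero
  | UOne
  | UAdd of uterm g & uterm g
  | UScale of K & uterm g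
  | UMul of uterm g & uterm g.
Arguments UZero {K g}.
Arguments UOne {K g}.

Inductive ueq (K : fieldType) (g : lieType K) : uterm g -> uterm g -> Prop :=
  | ueq_refl t : ueq t t
  | ueq_sym t u : ueq t u -> ueq u t
  | ueq_trans t u w : ueq t u -> ueq u w -> ueq t w
  | ueq_add t t' u u' : ueq t t' -> ueq u u' -> ueq (UAdd t u) (UAdd t' u')
  | ueq_scale a t t' : ueq t t' -> ueq (UScale a t) (UScale a t')
  | ueq_mul t t' u u' : ueq t t' -> ueq u u' -> ueq (UMul t u) (UMul t' u')
  | ueq_addA t u w : ueq (UAdd t (UAdd u w)) (UAdd (UAdd t u) w)
  | ueq_addC t u : ueq (UAdd t u) (UAdd u t)
  | ueq_add0 t : ueq (UAdd UZero t) t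
  | ueq_addN t : ueq (UAdd (UScale (-1) t) t) UZero
  | ueq_scaleA a b t : ueq (UScale a (UScale b t)) (UScale (a * b) t)
  | ueq_scale1 t : ueq (UScale 1 t) t
  | ueq_scaleDr a t u :
      ueq (UScale a (UAdd t u)) (UAdd (UScale a t) (UScale a u))
  | ueq_scaleDl a b t :
      ueq (UScale (a + b) t) (UAdd (UScale a t) (UScale b t))
  | ueq_mulA t u w : ueq (UMul t (UMul u w)) (UMul (UMul t u) w)
  | ueq_1mul t : ueq (UMul UOne t) t
  | ueq_mul1 t : ueq (UMul t UOne) t
  | ueq_mulDl t u w : ueq (UMul (UAdd t u) w) (UAdd (UMul t w) (UMul u w))
  | ueq_mulDr t u w : ueq (UMul t (UAdd u w)) (UAdd (UMul t u) (UMul t w))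
  | ueq_scaleAl a t u : ueq (UScale a (UMul t u)) (UMul (UScale a t) u)
  | ueq_scaleAr a t u : ueq (UScale a (UMul t u)) (UMul t (UScale a u))
  | ueq_gen_lin a x y :
      ueq (UGen (a *: x + y)) (UAdd (UScale a (UGen x)) (UGen y))
  | ueq_gen_lie x y :
      ueq (UAdd (UGen (lie x y)) (UMul (UGen y) (UGen x)))
          (UMul (UGen x) (UGen y)).

HB.instance Definition _ (K : fieldType) (g : lieType K) :=
  gen_eqMixin (uterm g).
HB.instance Definition _ (K : fieldType) (g : lieType K) :=
  gen_choiceMixin (uterm g).

Section Enveloping.
Variables (K : fieldType) (g : lieType K).

Definition ueqb (t u : uterm g) : bool := `[< ueq t u >].

Fact ueqb_equiv : equiv_class_of ueqb.
Proof.
split=> [t|t u|u t w].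
- exact/asboolP/ueq_refl.
- by apply/asboolP/asboolP; apply: ueq_sym.
- by move=> /asboolP tu /asboolP uw; apply/asboolP/(ueq_trans tu).
Qed.

Canonical ueqb_rel := EquivRelPack ueqb_equiv.
Canonical ueqb_encModRel := defaultEncModRel ueqb.

Definition envel := {eq_quot ueqb}.
HB.instance Definition _ : EqQuotient _ ueqb envel := EqQuotient.on envel.
HB.instance Definition _ := Choice.on envel.

Implicit Types (t u w : uterm g) (x y z : envel).

Lemma piP t u : ueq t u <-> \pi_envel t = \pi_envel u.
Proof. by split=> [tu|/eqmodP/asboolP//]; apply/eqmodP/asboolP. Qed.

Lemma repr_piP t : ueq (repr (\pi_envel t)) t.
Proof. by apply/piP; rewrite reprK. Qed.

Definition uadd x y : envel := \pi_envel (UAdd (repr x) (repr y)).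
Definition uscale (a : K) x : envel := \pi_envel (UScale a (repr x)).
Definition umul x y : envel := \pi_envel (UMul (repr x) (repr y)).

Lemma uaddE t u : uadd (\pi_envel t) (\pi_envel u) = \pi_envel (UAdd t u).
Proof. by apply/piP/ueq_add; apply: repr_piP. Qed.

Lemma uscaleE a t : uscale a (\pi_envel t) = \pi_envel (UScale a t).
Proof. by apply/piP/ueq_scale/repr_piP. Qed.

Lemma umulE t u : umul (\pi_envel t) (\pi_envel u) = \pi_envel (UMul t u).
Proof. by apply/piP/ueq_mul; apply: repr_piP. Qed.

Let uE := (uaddE, uscaleE, umulE).

Lemma envelP (P : envel -> Prop) : (forall t, P (\pi_envel t)) -> forall x, P x.
Proof. by move=> Ppi x; rewrite -[x]reprK. Qed.

Fact uaddA : associative uadd.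
Proof. by do 3!elim/envelP=> ?; rewrite !uE; apply/piP/ueq_addA. Qed.
Fact uaddC : commutative uadd.
Proof. by do 2!elim/envelP=> ?; rewrite !uE; apply/piP/ueq_addC. Qed.
Fact uadd0 : left_id (\pi_envel UZero) uadd.
Proof. by elim/envelP=> ?; rewrite !uE; apply/piP/ueq_add0. Qed.
Fact uaddN : left_inverse (\pi_envel UZero) (uscale (-1)) uadd.
Proof. by elim/envelP=> ?; rewrite !uE; apply/piP/ueq_addN. Qed.
HB.instance Definition _ := GRing.isZmodule.Build envel uaddA uaddC uadd0 uaddN.

Lemma piD t u : \pi_envel (UAdd t u) = \pi_envel t + \pi_envel u.
Proof. by rewrite -uaddE. Qed.

Fact uscaleA a b x : uscale a (uscale b x) = uscale (a * b) x.
Proof. by elim/envelP: x => ?; rewrite !uE; apply/piP/ueq_scaleA. Qed.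
Fact uscale1 : left_id 1 uscale.
Proof. by elim/envelP=> ?; rewrite !uE; apply/piP/ueq_scale1. Qed.
Fact uscaleDr : right_distributive uscale uadd.
Proof.
by move=> a; do 2!elim/envelP=> ?; rewrite !uE; apply/piP/ueq_scaleDr.
Qed.
Fact uscaleDl x a b : uscale (a + b) x = uadd (uscale a x) (uscale b x).
Proof. by elim/envelP: x => ?; rewrite !uE; apply/piP/ueq_scaleDl. Qed.
HB.instance Definition _ :=
  GRing.Zmodule_isLmodule.Build K envel uscaleA uscale1 uscaleDr uscaleDl.

Lemma piZ a t : \pi_envel (UScale a t) = a *: \pi_envel t.
Proof. by rewrite -uscaleE. Qed.

Fact umulA : associative umul.
Proof. by do 3!elim/envelP=> ?; rewrite !uE; apply/piP/ueq_mulA. Qed.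
Fact u1mul : left_id (\pi_envel UOne) umul.
Proof. by elim/envelP=> ?; rewrite !uE; apply/piP/ueq_1mul. Qed.
Fact umul1 : right_id (\pi_envel UOne) umul.
Proof. by elim/envelP=> ?; rewrite !uE; apply/piP/ueq_mul1. Qed.
Fact umulDl : left_distributive umul uadd.
Proof. by do 3!elim/envelP=> ?; rewrite !uE; apply/piP/ueq_mulDl. Qed.
Fact umulDr : right_distributive umul uadd.
Proof. by do 3!elim/envelP=> ?; rewrite !uE; apply/piP/ueq_mulDr. Qed.

(* Needed only to show that the algebra is non-trivial. *)
Fixpoint uaug t : K := match t with
  | UGen _ | UZero => 0
  | UOne => 1
  | UAdd t u => uaug t + uaug u
  | UScale a t => a * uaug t
  | UMul t u => uaug t * uaug u
  end.

Lemma ueq_aug t u : ueq t u -> uaug t = uaug u.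
Proof.
elim=> {t u} //=; do 1?[by move=> *; congruence].
- by move=> *; rewrite addrA.
- by move=> *; rewrite addrC.
- by move=> *; rewrite add0r.
- by move=> *; rewrite mulN1r addNr.
- by move=> *; rewrite mulrA.
- by move=> *; rewrite mul1r.
- by move=> *; rewrite mulrDr.
- by move=> *; rewrite mulrDl.
- by move=> *; rewrite mulrA.
- by move=> *; rewrite mul1r.
- by move=> *; rewrite mulr1.
- by move=> *; rewrite mulrDl.
- by move=> *; rewrite mulrDr.
- by move=> *; rewrite mulrA.
- by move=> *; rewrite mulrCA.
- by move=> *; rewrite mulr0 addr0.
- by move=> *; rewrite mulr0 addr0.
Qed.

Fact uone_neq0 : \pi_envel UOne != 0.
Proof.
by apply/eqP => /piP/ueq_aug /= /eqP; rewrite oner_eq0.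
Qed.
HB.instance Definition _ :=
  GRing.Zmodule_isNzRing.Build envel umulA u1mul umul1 umulDl umulDr uone_neq0.

Lemma piM t u : \pi_envel (UMul t u) = \pi_envel t * \pi_envel u.
Proof. by rewrite -umulE. Qed.

Fact uscaleAl (a : K) (x y : envel) : a *: (x * y) = a *: x * y.
Proof.
elim/envelP: x => t; elim/envelP: y => u.
by rewrite -piM -!piZ -piM; exact/piP/ueq_scaleAl.
Qed.
HB.instance Definition _ := GRing.Lmodule_isLalgebra.Build K envel uscaleAl.

Fact uscaleAr (a : K) (x y : envel) : a *: (x * y) = x * (a *: y).
Proof.
elim/envelP: x => t; elim/envelP: y => u.
by rewrite -piM -!piZ -piM; exact/piP/ueq_scaleAr.
Qed.
HB.instance Definition _ := GRing.Lalgebra_isAlgebra.Build K envel uscaleAr.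

Definition ugen (x : g) : envel := \pi_envel (UGen x).

Lemma ugen_lin a (x y : g) : ugen (a *: x + y) = a *: ugen x + ugen y.
Proof.
by rewrite /ugen -piZ -piD; exact/piP/ueq_gen_lin.
Qed.

Lemma ugen_lie (x y : g) : ugen (lie x y) = ugen x * ugen y - ugen y * ugen x.
Proof.
apply/eqP; rewrite eq_sym subr_eq; apply/eqP.
by rewrite /ugen -!piM -piD; exact/piP/ueq_sym/ueq_gen_lie.
Qed.

Section Action.
Variables (M : lmodType K) (rho : lieRep g M).

Fixpoint tact t (m : M) : M := match t with
  | UGen x => rho x m
  | UZero => 0
  | UOne => m
  | UAdd t u => tact t m + tact u m
  | UScale a t => a *: tact t m
  | UMul t u => tact t (tact u m)
  end.

Definition uact (x : envel) (m : M) : M := tact (repr x) m.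

Lemma tact_lin t a m m' : tact t (a *: m + m') = a *: tact t m + tact t m'.
Proof.
elim: t m m' => //= [x|m m'|t IHt u IHu m m'|b t IHt m m'|t IHt u IHu m m'].
- exact: rep_linr.
- by rewrite scaler0 addr0.
- by rewrite IHt IHu scalerDr addrACA.
- by rewrite IHt scalerDr !scalerA mulrC.
- by rewrite IHu IHt.
Qed.

Lemma tact0 t : tact t 0 = 0.
Proof.
have := tact_lin t (-1) 0 0.
by rewrite scaler0 addr0 scaleN1r addNr.
Qed.

Lemma ueq_tact t u : ueq t u -> forall m, tact t m = tact u m.
Proof.
elim=> {t u} //=.
- by move=> t u w _ tu _ uw m; rewrite tu.
- by move=> t t' u u' _ tt' _ uu' m; rewrite tt' uu'.
- by move=> a t t' _ tt' m; rewrite tt'.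
- by move=> t t' u u' _ tt' _ uu' m; rewrite tt' uu'.
- by move=> *; rewrite addrA.
- by move=> *; rewrite addrC.
- by move=> *; rewrite add0r.
- by move=> *; rewrite scaleN1r addNr.
- by move=> *; rewrite scalerA.
- by move=> *; rewrite scale1r.
- by move=> *; rewrite scalerDr.
- by move=> *; rewrite scalerDl.
- by move=> t u w m; rewrite -[X in X + _]scale1r tact_lin scale1r.
- by move=> a t u m; rewrite -[in RHS](addr0 (a *: _)) tact_lin tact0 addr0.
- by move=> *; rewrite rep_linl.
- by move=> *; rewrite rep_lie subrK.
Qed.

Lemma uactE t m : uact (\pi_envel t) m = tact t m.
Proof. exact/ueq_tact/repr_piP. Qed.

Lemma uact_gen (x : g) m : uact (ugen x) m = rho x m.
Proof. exact: uactE. Qed.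

Lemma uact1 m : uact 1 m = m.
Proof. exact: (uactE UOne). Qed.

Lemma uactM x y m : uact (x * y) m = uact x (uact y m).
Proof. by elim/envelP: x => t; elim/envelP: y => u; rewrite -piM !uactE. Qed.

Lemma uact_linl a x y m : uact (a *: x + y) m = a *: uact x m + uact y m.
Proof.
by elim/envelP: x => t; elim/envelP: y => u; rewrite -piZ -piD !uactE.
Qed.

Lemma uact_linr x a m m' : uact x (a *: m + m') = a *: uact x m + uact x m'.
Proof. exact: tact_lin. Qed.
End Action.

Fact regular_linl a (x y : g) (u : envel) :
  ugen (a *: x + y) * u = a *: (ugen x * u) + ugen y * u.
Proof. by rewrite ugen_lin mulrDl scalerAl. Qed.

Fact regular_linr a (x : g) (u v : envel) :
  ugen x * (a *: u + v) = a *: (ugen x * u) + ugen x * v.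
Proof. by rewrite mulrDr scalerAr. Qed.

Fact regular_lie (x y : g) (u : envel) :
  ugen (lie x y) * u = ugen x * (ugen y * u) - ugen y * (ugen x * u).
Proof. by rewrite ugen_lie mulrBl !mulrA. Qed.

Definition regular_rep : lieRep g envel :=
  LieRep regular_linl regular_linr regular_lie.
End Enveloping.

(* The algebra morphism U(g) -> U(g') induced by f : g -> g', obtained by letting
   U(g) act on U(g') by left multiplication through f. *)
Definition envel_map (K : fieldType) (g g' : lieType K) (f : lieHom g g')
    (u : envel g) : envel g' :=
  uact (rep_pull f (regular_rep g')) u 1.

Lemma envel_map_gen (K : fieldType) (g g' : lieType K) (f : lieHom g g') x :
  envel_map f (ugen x) = ugen (f x).
Proof. by rewrite /envel_map uact_gen /= mulr1. Qed.

Section LinearExtension.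
Variables (K : fieldType) (I : choiceType) (V : lmodType K).

Definition lext (b : I -> V) (x : {malg K[I]}) : V :=
  \sum_(i <- msupp x) x@_i *: b i.

Lemma lextEw b x (d : {fset I}) : (msupp x `<=` d)%fset ->
  lext b x = \sum_(i <- d) x@_i *: b i.
Proof.
move=> le_xd; apply: big_fset_incl => // i _ /mcoeff_outdom ->.
by rewrite scale0r.
Qed.

Lemma lext_lin b a x y : lext b (a *: x + y) = a *: lext b x + lext b y.
Proof.
have sub : (msupp (a *: x + y) `<=` msupp x `|` msupp y)%fset.
  by apply: fsubset_trans (msuppD_le _ _) _; apply/fsetSU/msuppZ_le.
rewrite (lextEw _ sub) (lextEw _ (fsubsetUl _ (msupp y))).
rewrite (lextEw _ (fsubsetUr (msupp x) _)) scaler_sumr -big_split /=.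
by apply: eq_bigr => i _; rewrite mcoeffD mcoeffZ scalerDl scalerA.
Qed.

Lemma lextU b i : lext b << i >> = b i.
Proof. by rewrite /lext msuppU oner_eq0 big_seq_fset1 mcoeffUU scale1r. Qed.

Lemma lin_ext (f f' : {malg K[I]} -> V) :
    (forall a x y, f (a *: x + y) = a *: f x + f y) ->
    (forall a x y, f' (a *: x + y) = a *: f' x + f' y) ->
  (forall i, f << i >> = f' << i >>) -> forall x, f x = f' x.
Proof.
move=> lf lf' ff' x.
have f0 (h : {malg K[I]} -> V) :
    (forall a x y, h (a *: x + y) = a *: h x + h y) -> h 0 = 0.
  by move/(_ (-1) 0 0); rewrite scaler0 addr0 scaleN1r addNr.
have -> : x = \sum_(i <- msupp x) x@_i *: << i >>.
  rewrite {1}[x]monalgE; apply: eq_bigr => i _; apply/malgP => k.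
  by rewrite mcoeffZ !mcoeffU mulr_natr.
elim: (enum_fset _) => [|i s IHs]; first by rewrite big_nil !f0.
by rewrite big_cons lf lf' ff' IHs.
Qed.
End LinearExtension.

Section BilinearExtension.
Variables (K : fieldType) (I J : choiceType) (V : lmodType K).

Definition bilext (b : I -> J -> V) (x : {malg K[I]}) (y : {malg K[J]}) : V :=
  lext (fun i => lext (b i) y) x.

Lemma bilext_linl b a x x' y :
  bilext b (a *: x + x') y = a *: bilext b x y + bilext b x' y.
Proof. exact: lext_lin. Qed.

Lemma bilext_linr b x a y y' :
  bilext b x (a *: y + y') = a *: bilext b x y + bilext b x y'.
Proof.
rewrite /bilext [LHS]/lext.
under eq_bigr => i _ do rewrite lext_lin scalerDr scalerA mulrC -scalerA.
by rewrite big_split -scaler_sumr.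
Qed.

Lemma bilextU b i j : bilext b << i >> << j >> = b i j.
Proof. by rewrite /bilext !lextU. Qed.
End BilinearExtension.

(* The basis vector of index Some n is L_n, the one of index None is C. *)
Definition vir (K : numFieldType) := {malg K[option int]}.
HB.instance Definition _ (K : numFieldType) := GRing.Lmodule.on (vir K).

Section Rearrangement.
Variables (K : fieldType) (V : lmodType K).
Implicit Types (a b : K) (u v w : V).

Lemma addr_rot u v w : u + v + w = v + w + u.
Proof. by rewrite -addrA addrC. Qed.

Lemma lin3_arr a u v w u' v' w' :
  a *: u + u' + (a *: v + v') + (a *: w + w')
  = a *: (u + v + w) + (u' + v' + w').
Proof. by rewrite !scalerDr [a *: u + u' + _]addrACA [LHS]addrACA. Qed.

Lemma comb3_arr a b a' b' a'' b'' u v :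
  a *: u + b *: v + (a' *: u + b' *: v) + (a'' *: u + b'' *: v)
  = (a + a' + a'') *: u + (b + b' + b'') *: v.
Proof. by rewrite !scalerDl [a *: u + b *: v + _]addrACA [LHS]addrACA. Qed.

Lemma linB_arr a u u' w w' :
  a *: u + u' - (a *: w + w') = a *: (u - w) + (u' - w').
Proof. by rewrite scalerBr opprD addrACA. Qed.
End Rearrangement.

Section Virasoro.
Variable K : numFieldType.

Definition L (n : int) : vir K := << Some n >>.
Definition C : vir K := << None >>.

Definition vir_bracket (i j : option int) : vir K :=
  match i, j with
  | Some m, Some n =>
      (m - n)%:~R *: L (m + n) +
      (if m + n == 0 then ((m ^+ 3 - m)%:~R / 12) *: C else 0)
  | _, _ => 0
  end.

Definition vir_lie (x y : vir K) : vir K := bilext vir_bracket x y.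

Fact vir_linl (a : K) x y z :
  vir_lie (a *: x + y) z = a *: vir_lie x z + vir_lie y z.
Proof. exact: bilext_linl. Qed.

Fact vir_linr (a : K) x y z :
  vir_lie x (a *: y + z) = a *: vir_lie x y + vir_lie x z.
Proof. exact: bilext_linr. Qed.

Lemma vir_lieE i j : vir_lie << i >> << j >> = vir_bracket i j.
Proof. exact: bilextU. Qed.

Lemma vir_bracketN i j : vir_bracket i j = - vir_bracket j i.
Proof.
case: i j => [m|] [n|] //=; rewrite ?oppr0 //.
rewrite [n + m]addrC opprD -scaleNr -rmorphN opprB; congr (_ + _).
case: eqP => [mn0|]; last by rewrite oppr0.
have -> : n = - m by apply/eqP; rewrite -addr_eq0 addrC mn0.
by rewrite -scaleNr -mulNr -rmorphN; congr ((_%:~R / _) *: _); ring.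
Qed.

Lemma vir_lieN x y : vir_lie x y = - vir_lie y x.
Proof.
move: x; apply: lin_ext => [a u v|a u v|i]; rewrite ?vir_linl //.
  by rewrite vir_linr opprD scalerN.
move: y; apply: lin_ext => [a u v|a u v|j]; rewrite ?vir_linr //.
  by rewrite vir_linl opprD scalerN.
by rewrite !vir_lieE vir_bracketN.
Qed.

Fact vir_liexx x : vir_lie x x = 0.
Proof.
have /eqP := vir_lieN x x; rewrite -addr_eq0 -mulr2n -scaler_nat.
by rewrite scaler_eq0 pnatr_eq0 /= => /eqP.
Qed.

Let jac x y z := vir_lie x (vir_lie y z) + vir_lie y (vir_lie z x)
  + vir_lie z (vir_lie x y).

Let jac_rot x y z : jac x y z = jac y z x.
Proof. exact: addr_rot. Qed.

Let jac_lin a x x' y z : jac (a *: x + x') y z = a *: jac x y z + jac x' y z.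
Proof.
rewrite /jac -lin3_arr; congr (_ + _ + _); first exact: vir_linl.
  by apply: (etrans (congr1 _ (vir_linr _ _ _ _))); apply: vir_linr.
by apply: (etrans (congr1 _ (vir_linl _ _ _ _))); apply: vir_linr.
Qed.

Let lie0 x : vir_lie x 0 = 0.
Proof. by have := vir_linr (-1) x 0 0; rewrite scaler0 addr0 scaleN1r addNr. Qed.

Lemma vir_lieC x : vir_lie C x = 0.
Proof. by rewrite /vir_lie /bilext lextU /lext big1 // => i _; rewrite scaler0. Qed.

Let cocycle (m n : int) : K := (m + n == 0)%:R * ((m ^+ 3 - m)%:~R / 12).

Let vir_bracketE m n : vir_bracket (Some m) (Some n) =
  (m - n)%:~R *: L (m + n) + cocycle m n *: C.
Proof. by rewrite /= /cocycle; case: eqP; rewrite ?mul1r ?mul0r ?scale0r. Qed.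

Let vir_lieL2 m n p : vir_lie (L m) (vir_lie (L n) (L p)) =
  ((n - p) * (m - (n + p)))%:~R *: L (m + n + p)
  + ((n - p)%:~R * cocycle m (n + p)) *: C.
Proof.
have lieLC : vir_lie (L m) (cocycle n p *: C) = 0.
  apply: (etrans (congr1 _ (esym (addr0 _)))); apply: (etrans (vir_linr _ _ _ _)).
  by rewrite lie0 addr0 vir_lieN vir_lieC oppr0 scaler0.
rewrite (vir_lieE (Some n)) vir_bracketE; apply: (etrans (vir_linr _ _ _ _)).
rewrite lieLC addr0 (vir_lieE (Some m)) vir_bracketE.
by rewrite scalerDr !scalerA -intrM addrA.
Qed.

Let jac_C y z : jac C y z = 0.
Proof.
rewrite /jac vir_lieC (vir_lieC y) (vir_lieN z C) vir_lieC oppr0 !lie0.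
by rewrite !addr0.
Qed.

Let jac_L m n p : jac (L m) (L n) (L p) = 0.
Proof.
rewrite /jac 3!vir_lieL2.
have -> : n + p + m = m + n + p by ring.
have -> : p + m + n = m + n + p by ring.
rewrite comb3_arr -!intrD.
have -> : (n - p) * (m - (n + p)) + (p - m) * (n - (p + m))
          + (m - n) * (p - (m + n)) = 0 by ring.
rewrite scale0r add0r /cocycle.
have -> : n + (p + m) = m + (n + p) by ring.
have -> : p + (m + n) = m + (n + p) by ring.
case: eqP => [mnp0|_]; last by rewrite !mul0r !mulr0 !addr0 scale0r.
have -> : m = - (n + p) by apply/eqP; rewrite -addr_eq0 mnp0.
rewrite !mul1r !mulrA -!mulrDl -!intrM -!intrD.
set k := (X in X%:~R); suff -> : k = 0 by rewrite mul0r scale0r.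
by rewrite /k; ring.
Qed.

Fact vir_jacobi x y z : jac x y z = 0.
Proof.
have lin0 a (u v : vir K) : 0 = a *: 0 + 0 :> vir K by rewrite scaler0 addr0.
move: x; apply: (lin_ext (f' := fun=> 0)) => [a u v||i]; rewrite ?jac_lin //.
rewrite jac_rot; move: y.
apply: (lin_ext (f' := fun=> 0)) => [a u v||j]; rewrite ?jac_lin //.
rewrite jac_rot; move: z.
apply: (lin_ext (f' := fun=> 0)) => [a u v||k]; rewrite ?jac_lin //.
case: k => [p|]; last exact: jac_C.
rewrite jac_rot; case: i => [m|]; last exact: jac_C.
rewrite jac_rot; case: j => [n|]; last exact: jac_C.
exact: jac_L.
Qed.

HB.instance Definition _ := Lmodule_isLie.Build K (vir K)
  vir_linl vir_linr vir_liexx vir_jacobi.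

End Virasoro.

Arguments L {K} n.
Arguments C {K}.

(* M(c, h) is the quotient of U(Vir) by the left ideal generated by the L_n
   (n > 0), L_0 - h and C - c; its generator v is the class of 1. *)
Section Verma.
Variables (K : numFieldType) (c h : K).

Inductive verma_ideal : envel (vir K) -> Prop :=
  | verma_ideal0 : verma_ideal 0
  | verma_idealD x y : verma_ideal x -> verma_ideal y -> verma_ideal (x + y)
  | verma_idealM u x : verma_ideal x -> verma_ideal (u * x)
  | verma_ideal_pos n : 0 < n -> verma_ideal (ugen (L n))
  | verma_ideal_L0 : verma_ideal (ugen (L 0) - h%:A)
  | verma_ideal_C : verma_ideal (ugen C - c%:A).

Definition verma_idealb : {pred envel (vir K)} := fun x => `[< verma_ideal x >].

Fact verma_ideal_closed : zmod_closed verma_idealb.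
Proof.
split; first exact/asboolP/verma_ideal0.
move=> x y /asboolP Ix /asboolP Iy; apply/asboolP/verma_idealD => //.
by rewrite -mulN1r; apply: verma_idealM.
Qed.
HB.instance Definition _ :=
  GRing.isZmodClosed.Build (envel (vir K)) verma_idealb verma_ideal_closed.

Definition verma := Quotient.quot verma_idealb.
HB.instance Definition _ := GRing.Zmodule.on verma.

Definition verma_pi (x : envel (vir K)) : verma := \pi_verma x.

Lemma verma_piP x y : verma_pi x = verma_pi y <-> verma_ideal (x - y).
Proof.
rewrite /verma_pi; split=> [/eqP|Ixy]; last apply/eqP; rewrite -Quotient.idealrBE.
  exact: asboolW.
exact/asboolP.
Qed.

Lemma verma_piD x y : verma_pi (x + y) = verma_pi x + verma_pi y.
Proof. exact: raddfD. Qed.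

Lemma vermaP (P : verma -> Prop) : (forall x, P (verma_pi x)) -> forall v, P v.
Proof. by move=> Ppi v; rewrite -[v]reprK; apply: Ppi. Qed.

Definition verma_mul (u : envel (vir K)) (v : verma) : verma :=
  verma_pi (u * repr v).

Lemma verma_mulE u x : verma_mul u (verma_pi x) = verma_pi (u * x).
Proof.
apply/verma_piP; rewrite -mulrBr; apply/verma_idealM/verma_piP.
by rewrite [LHS]reprK.
Qed.

Lemma verma_mulDr u : {morph verma_mul u : v w / v + w}.
Proof.
elim/vermaP=> x; elim/vermaP=> y.
by rewrite -verma_piD !verma_mulE mulrDr verma_piD.
Qed.

Lemma verma_mulDl v : {morph verma_mul^~ v : x y / x + y}.
Proof.
by move=> x y; elim/vermaP: v => z; rewrite !verma_mulE mulrDl verma_piD.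
Qed.

Lemma verma_mulA x y v : verma_mul x (verma_mul y v) = verma_mul (x * y) v.
Proof. by elim/vermaP: v => z; rewrite !verma_mulE mulrA. Qed.

Definition verma_scale (a : K) : verma -> verma := verma_mul a%:A.

Fact verma_scaleA a b v :
  verma_scale a (verma_scale b v) = verma_scale (a * b) v.
Proof. by rewrite /verma_scale verma_mulA -scalerAl mul1r scalerA. Qed.

Fact verma_scale1 : left_id 1 verma_scale.
Proof. by elim/vermaP=> x; rewrite /verma_scale scale1r verma_mulE mul1r. Qed.

Fact verma_scaleDr : right_distributive verma_scale +%R.
Proof. by move=> a v w; apply: verma_mulDr. Qed.

Fact verma_scaleDl v : {morph verma_scale^~ v : a b / a + b}.
Proof. by move=> a b; rewrite /verma_scale scalerDl verma_mulDl. Qed.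

HB.instance Definition _ := GRing.Zmodule_isLmodule.Build K verma
  verma_scaleA verma_scale1 verma_scaleDr verma_scaleDl.

Lemma verma_scaleE (a : K) (v : verma) : a *: v = verma_mul a%:A v.
Proof. by []. Qed.

Fact verma_linl (a : K) (x y : vir K) (v : verma) :
  verma_mul (ugen (a *: x + y)) v
  = a *: verma_mul (ugen x) v + verma_mul (ugen y) v.
Proof.
by rewrite ugen_lin verma_mulDl verma_scaleE verma_mulA -scalerAl mul1r.
Qed.

Fact verma_linr (a : K) (x : vir K) (v w : verma) :
  verma_mul (ugen x) (a *: v + w)
  = a *: verma_mul (ugen x) v + verma_mul (ugen x) w.
Proof.
by rewrite verma_mulDr !verma_scaleE !verma_mulA -scalerAl -scalerAr mul1r mulr1.
Qed.

Fact verma_lie (x y : vir K) (v : verma) :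
  verma_mul (ugen (lie x y)) v
  = verma_mul (ugen x) (verma_mul (ugen y) v)
    - verma_mul (ugen y) (verma_mul (ugen x) v).
Proof.
apply/eqP; rewrite eq_sym subr_eq !verma_mulA -verma_mulDl.
by rewrite ugen_lie subrK.
Qed.

Definition verma_rep : lieRep (vir K) verma :=
  LieRep verma_linl verma_linr verma_lie.

Definition verma_vec : verma := verma_pi 1.

Lemma verma_vec_pos n : 0 < n -> verma_rep (L n) verma_vec = 0.
Proof.
move=> n_gt0; rewrite /= verma_mulE mulr1 -[RHS](raddf0 \pi_verma).
by apply/verma_piP; rewrite subr0; apply: verma_ideal_pos.
Qed.

Lemma verma_vec_L0 : verma_rep (L 0) verma_vec = h *: verma_vec.
Proof.
rewrite /= verma_scaleE !verma_mulE !mulr1; exact/verma_piP/verma_ideal_L0.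
Qed.

Lemma verma_vec_C : verma_rep C verma_vec = c *: verma_vec.
Proof.
rewrite /= verma_scaleE !verma_mulE !mulr1; exact/verma_piP/verma_ideal_C.
Qed.

End Verma.

(* All the modules V_{la, mu} share one underlying space, with basis
   v_n = << n >>; only the action depends on la and mu. *)
Section Density.
Variables (K : numFieldType) (la mu : K).

Definition density : Type := {malg K[int]}.
HB.instance Definition _ := GRing.Lmodule.on density.

Definition density_basis (i : option int) (n : int) : density :=
  if i is Some k then - (n%:~R + la * k%:~R + mu) *: << n + k >> else 0.

Definition density_act (x : vir K) (v : density) : density :=
  bilext density_basis x v.

Fact density_linl (a : K) (x y : vir K) (v : density) :
  density_act (a *: x + y) v = a *: density_act x v + density_act y v.
Proof. exact: bilext_linl. Qed.

Fact density_linr (a : K) (x : vir K) (v w : density) :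
  density_act x (a *: v + w) = a *: density_act x v + density_act x w.
Proof. exact: bilext_linr. Qed.

Lemma density_act0 v : density_act 0 v = 0.
Proof.
by have := density_linl (-1) 0 0 v; rewrite scaler0 addr0 scaleN1r addNr.
Qed.

Lemma density_actE i n : density_act << i >> << n >> = density_basis i n.
Proof. exact: bilextU. Qed.

Lemma density_actC v : density_act C v = 0.
Proof.
by rewrite /density_act /bilext lextU /lext big1 // => i _; rewrite scaler0.
Qed.

Fact density_lie (x y : vir K) (v : density) :
  density_act (lie x y) v
  = density_act x (density_act y v) - density_act y (density_act x v).
Proof.
have act0 z : density_act z 0 = 0.
  by have := density_linr (-1) z 0 0; rewrite scaler0 addr0 scaleN1r addNr.
move: x; apply: lin_ext => [a u u'|a u u'|i].
- by rewrite lie_linl density_linl.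
- by rewrite !(density_linl, density_linr) linB_arr.
move: y; apply: lin_ext => [a u u'|a u u'|j].
- by rewrite lie_linr density_linl.
- by rewrite !(density_linl, density_linr) linB_arr.
move: v; apply: lin_ext => [a u u'|a u u'|n]; first exact: density_linr.
  by rewrite !density_linr linB_arr.
rewrite -[lie _ _]/(vir_lie _ _) vir_lieE.
case: i j => [k|] [l|]; last 3 first.
- by rewrite /= -[<< None >>]/C !density_actC ?act0 subrr density_act0.
- by rewrite /= -[<< None >>]/C !density_actC ?act0 subrr density_act0.
- by rewrite /= -[<< None >>]/C !density_actC ?act0 subrr density_act0.
have centr b (t : K) : density_act (if b then t *: C else 0) << n >> = 0.
  case: b; last exact: density_act0.
  by rewrite -[t *: C]addr0 density_linl density_actC scaler0 add0r density_act0.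
have actZ x a v : density_act x (a *: v) = a *: density_act x v.
  by rewrite -[a *: v]addr0 density_linr act0 addr0.
apply: (etrans (density_linl _ _ _ _)); rewrite centr addr0 /L.
rewrite 3!density_actE ![density_basis _ _]/= !actZ 2!density_actE.
rewrite ![density_basis _ _]/= !scalerA -!addrA [l + k]addrC -scalerBl.
congr (_ *: _); rewrite !(intrD, intrB); ring.
Qed.

Definition density_rep : lieRep (vir K) density :=
  LieRep density_linl density_linr density_lie.

Definition density_vec (n : int) : density := << n >>.

Lemma density_repL k n : density_rep (L k) (density_vec n) =
  - (n%:~R + la * k%:~R + mu) *: density_vec (n + k).
Proof. exact: density_actE. Qed.
End Density.

Arguments density_vec {K} n.

(* lower m is the Lie subalgebra of vir spanned by the L_{-k} with k > m; the
   strict inequality makes it a subalgebra avoiding C for every m. *)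
Section Lower.
Variables (K : numFieldType) (m : nat).

Definition lower_span : {pred vir K} :=
  fun x => all (fun i => if i is Some n then n < - m%:Z else false) (msupp x).

Lemma lower_spanP x : reflect
  (forall i, x@_i != 0 -> if i is Some n then n < - m%:Z else false)
  (x \in lower_span).
Proof.
apply: (iffP allP) => sx i; first by rewrite mcoeff_neq0; apply: sx.
by move=> xi; apply: sx; rewrite mcoeff_neq0.
Qed.

Fact lower_closed : subsemimod_closed lower_span.
Proof.
split; first split.
- by apply/lower_spanP => i; rewrite mcoeff0 eqxx.
- move=> x y /lower_spanP sx /lower_spanP sy; apply/lower_spanP => i.
  rewrite mcoeffD; have [xi0|/sx//] := eqVneq x@_i 0.
  by rewrite xi0 add0r; apply: sy.
- move=> a x /lower_spanP sx; apply/lower_spanP => i.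
  by rewrite mcoeffZ mulf_eq0 negb_or => /andP[_ /sx].
Qed.
HB.instance Definition _ :=
  GRing.isSubmodClosed.Build K (vir K) lower_span lower_closed.

Record lower := Lower { lower_val :> vir K; _ : lower_span lower_val }.
HB.instance Definition _ := [isSub for lower_val].
HB.instance Definition _ := [Choice of lower by <:].
HB.instance Definition _ := [SubChoice_isSubLmodule of lower by <:].

Fact lower_val_lin (a : K) (x y : lower) :
  lower_val (a *: x + y) = a *: lower_val x + lower_val y.
Proof. exact: (linearP val). Qed.

Fact lower_lie_subproof (x y : lower) :
  lower_span (lie (lower_val x) (lower_val y)).
Proof.
rewrite -[lower_span _]/(_ \in lower_span) -[lie _ _]/(vir_lie _ _).
rewrite /vir_lie /bilext /lext big_seq rpred_sum // => i.
case: x => /= x /allP sx /sx; case: i => // k lt_km; apply: rpredZ.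
rewrite big_seq rpred_sum // => j.
case: y => /= y /allP sy /sy; case: j => // l lt_lm; apply: rpredZ.
have lt_kl : k + l < - m%:Z by lia.
have /negPf -> : k + l != 0 by lia.
rewrite addr0; apply: rpredZ; apply/lower_spanP => i.
by rewrite mcoeffU; case: (Some _ =P i) => [<-//|_]; rewrite eqxx.
Qed.

Definition lower_lie x y := Lower (lower_lie_subproof x y).

Fact lower_linl (a : K) x y z :
  lower_lie (a *: x + y) z = a *: lower_lie x z + lower_lie y z.
Proof. by apply: val_inj; rewrite /= lie_linl. Qed.

Fact lower_linr (a : K) x y z :
  lower_lie x (a *: y + z) = a *: lower_lie x y + lower_lie x z.
Proof. by apply: val_inj; rewrite /= lie_linr. Qed.

Fact lower_liexx x : lower_lie x x = 0.
Proof. by apply: val_inj; apply: liexx. Qed.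

Fact lower_jacobi x y z : lower_lie x (lower_lie y z)
  + lower_lie y (lower_lie z x) + lower_lie z (lower_lie x y) = 0.
Proof. by apply: val_inj; apply: lie_jacobi. Qed.

HB.instance Definition _ := Lmodule_isLie.Build K lower
  lower_linl lower_linr lower_liexx lower_jacobi.

Definition lower_incl : lieHom lower (vir K) :=
  LieHom lower_val_lin (fun _ _ => erefl).
End Lower.

Section SingularElement.
Variable K : numFieldType.

(* These are generated by the L_{-k} with k >= 1, resp. k >= 2. *)
Definition U1 := envel (lower K 0).
Definition U2 := envel (lower K 1).

Fact lower21_subproof (x : lower K 1) : lower_span 0 (lower_val x).
Proof.
by case: x => x /= /allP sx; apply/allP => i /sx; case: i => // n; lia.
Qed.

Definition lower21 (x : lower K 1) : lower K 0 := Lower (lower21_subproof x).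

Fact lower21_lin (a : K) (x y : lower K 1) :
  lower21 (a *: x + y) = a *: lower21 x + lower21 y.
Proof. exact: val_inj. Qed.

Fact lower21_lie (x y : lower K 1) :
  lower21 (lie x y) = lie (lower21 x) (lower21 y).
Proof. exact: val_inj. Qed.

Definition U2_incl : U2 -> U1 :=
  envel_map (LieHom lower21_lin lower21_lie).

Fact Lm1_subproof : lower_span 0 (L (-1) : vir K).
Proof.
by apply/allP => i; rewrite /L msuppU oner_eq0 in_fset1 => /eqP ->.
Qed.

Definition Lm1 : lower K 0 := Lower Lm1_subproof.

(* The total degree, where L_{-k} has degree k. *)
Inductive homogeneous : nat -> U1 -> Prop :=
  | homogeneous1 : homogeneous 0 1
  | homogeneous0 d : homogeneous d 0
  | homogeneous_lin d (a : K) u w :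
      homogeneous d u -> homogeneous d w -> homogeneous d (a *: u + w)
  | homogeneousM d k (x : lower K 0) u :
      lower_val x = L (- k%:Z) -> homogeneous d u ->
    homogeneous (k + d) (ugen x * u).

Definition U1_act (M : lmodType K) (rho : lieRep (vir K) M) : U1 -> M -> M :=
  uact (rep_pull (lower_incl K 0) rho).

Definition singular (M : lmodType K) (rho : lieRep (vir K) M) (e : K) (w : M) :=
  [/\ w <> 0, rho (L 0) w = e *: w & forall n, 0 < n -> rho (L n) w = 0].

(* P v is singular of energy (j + 1)^2 in M(1, j^2), and P is normalized by
   q_d = 1, where q_k \in U_2 is the coefficient of L_{-1}^k in P. *)
Definition normalized_singular_element (j : K) (d : nat) (P : U1) : Prop :=
  [/\ homogeneous d P,
      exists q : nat -> U2,
        P = \sum_(k < d.+1) U2_incl (q k) * ugen Lm1 ^+ k /\ q d = 1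
    & singular (verma_rep 1 (j ^+ 2)) ((j + 1) ^+ 2)
        (U1_act (verma_rep 1 (j ^+ 2)) P (verma_vec 1 (j ^+ 2)))].

(* The sequence -j, -j+1, ..., j, when d = 2 j + 1. *)
Definition spins (j : K) (d : nat) : seq K :=
  [seq - j + i%:R | i <- iota 0 d].

End SingularElement.

(* Main.v *)
Require Import Defs.
From HB Require Import structures.
From mathcomp Require Import all_boot all_order all_fingroup all_algebra.
From mathcomp Require Import finmap monalg boolp reals complex ring zify.

Set Implicit Arguments.
Unset Strict Implicit.
Unset Printing Implicit Defensive.

Import Order.TTheory GRing.Theory Num.Theory.
Local Open Scope ring_scope.
Local Notation "1" := (@mone _) : monom_scope.
Local Notation "x * y" := (mmul x y) : monom_scope.

(* Let [F_k] be the bosonic Fock space of momentum [k]: polynomials in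
   [x_1, x_2, ...] with [b_{-n} = x_n], [b_n = (n/2) d/dx_n], [b_0 = k], on which
   [L_m = sum_i :b_i b_{m-i}:] has central charge 1.

   For [k] in [{-j, ..., j}], the rectangular Schur vector with [r = j + k] rows
   and [c = j - k] columns is a highest weight vector [w_k] of weight [j^2] in
   [F_k]. The contravariant form of [F_k] is positive definite, so the singular
   vector [P w_k], being orthogonal to the image of all the [L_{-n}], is zero.

   The substitution [x_n := p] turns the action of [L_{-n}] on [F_k] into the one
   on the density module with [la = p^2] and [mu = (k - p)^2 - j^2]. Applied to
   [P w_k = 0] it gives [a_d(p^2, (k - p)^2 - j^2) = 0] whenever [w_k] does not
   vanish at [x_n := p], thus for all but finitely many [p]. As [q_d = 1], the
   polynomial [a_d(p^2, mu)] has degree [d] and leading coefficient [(-1)^d] in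
   [mu]: these [d] roots determine it for generic [p], hence for all [p]. *)

(** * Polynomials in arbitrarily many variables *)

(** The commutator [[b_m, b_{-m}] = m/2] gives the vacuum of [F_k] the weight [k^2]; an [r] by [c]
    rectangle adds [r c = j^2 - k^2].

    The vector [w_k] is not built from tableaux but as a constant term: that of
    [Delta(z)^2 prod_i z_i^{-B} H(z_i)] with [B = c + r - 1], the shape produced by [r] screening
    operators. On such constant terms [L_n], [n >= 0], is a first-order differential operator in
    [z]; squaring the Vandermonde product cancels its quadratic power sums, and [2 k = r - c]
    cancels the rest. To see that [w_k] vanishes at finitely many [p] only, one value of [p] is
    enough: at [p = - c/2], [H(z)] becomes the polynomial [(1 - z)^c].

    Putting all [x_n] equal makes the creation-annihilation part of [L_{-n}] independent of [n], so
    that it can be read off the energy.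

    For a fixed [la] the roots in [mu] can collide: at [la = 0], those of [k] and [-k] do.
    Multiplicities are out of reach there, and the formula is continued from large integers [p]. *)

(* The polynomial algebra is sealed behind its universal property: unification
   would otherwise unfold the operations of [malg]. *)
Record monomial_algebra (K : numFieldType) (I : choiceType) := MonomialAlgebra {
  mcarrier :> comAlgType K;
  mono : {cmonom I} -> mcarrier;
  mono1 : mono 1%M = 1;
  monoM : forall m1 m2, mono (m1 * m2)%M = mono m1 * mono m2;
  mext : forall V : lmodType K, ({cmonom I} -> V) -> mcarrier -> V;
  mext_linear : forall (V : lmodType K) (b : {cmonom I} -> V), linear (mext b);
  mextU : forall (V : lmodType K) (b : {cmonom I} -> V) m, mext b (mono m) = b m;
  mono_ind : forall Q : mcarrier -> Prop, Q 0 ->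
    (forall a m f, Q f -> Q (a *: mono m + f)) -> forall f, Q f
}.

Fact malg_scaleU (K : numFieldType) (I : choiceType) (m : I) (a : K) :
  << a *g m >> = a *: << m >> :> {malg K[I]}.
Proof. by apply/malgP => m'; rewrite mcoeffZ !mcoeffU mulr_natr. Qed.

Definition polyalg (K : numFieldType) (I : choiceType) : monomial_algebra K I.
Proof.
exists (GRing.ComAlgebra.clone K {malg K[{cmonom I}]} _) (fun m => << m >>)
  (fun V b => lext b) => //.
- by move=> m1 m2; rewrite malgM_def fgmulUU mulr1.
- by move=> V b a f g; apply: lext_lin.
- by move=> V b m; rewrite lextU.
move=> Q Q0 QD f; rewrite [f]monalgE.
elim: (enum_fset _) => [|m s IHs]; first by rewrite big_nil.
by rewrite big_cons malg_scaleU; apply: QD.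
Qed.

Section PolynomialAlgebra.
Variables (K : numFieldType) (I : choiceType).
Local Notation P := (polyalg K I).
Implicit Types (i j : I) (m : {cmonom I}) (f g : P) (V : lmodType K).

HB.instance Definition _ V (b : {cmonom I} -> V) :=
  GRing.isLinear.Build K P V _ (@mext K I P V b) (mext_linear b).

Lemma eq_on_mono V (F G : P -> V) : linear F -> linear G ->
  (forall m, F (mono P m) = G (mono P m)) -> F =1 G.
Proof.
move=> linF linG FG; have lin0 (H : P -> V) : linear H -> H 0 = 0.
  by move/(_ (-1) 0 0); rewrite scaler0 addr0 scaleN1r addNr.
by apply: mono_ind => [|a m f IHf]; rewrite ?lin0 // linF linG FG IHf.
Qed.

Lemma eq_on_mono2 V (F G : P -> P -> V) :
    (forall g, linear (F^~ g)) -> (forall f, linear (F f)) ->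
    (forall g, linear (G^~ g)) -> (forall f, linear (G f)) ->
    (forall m1 m2, F (mono P m1) (mono P m2) = G (mono P m1) (mono P m2)) ->
  forall f g, F f g = G f g.
Proof.
move=> Fl Fr Gl Gr FG f g; apply: (eq_on_mono (Fl g) (Gl g)) => m1.
exact: (eq_on_mono (Fr _) (Gr _)).
Qed.

Definition px i : P := mono P (ucm i).

Definition pd i : P -> P := mext (fun m => (m i)%:R *: mono P (divcm m (ucm i))).
HB.instance Definition _ i := GRing.Linear.on (pd i).

Lemma pdU i m : pd i (mono P m) = (m i)%:R *: mono P (divcm m (ucm i)).
Proof. exact: mextU. Qed.

Lemma pdP i a f g : pd i (a *: f + g) = a *: pd i f + pd i g.
Proof. exact: linearP. Qed.

Lemma pdZ i a f : pd i (a *: f) = a *: pd i f.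
Proof. exact: linearZ. Qed.

Lemma pdM i f g : pd i (f * g) = pd i f * g + f * pd i g.
Proof.
move: f g; apply: eq_on_mono2 => [g a f f'|f a g g'|g a f f'|f a g g'|m1 m2].
- by rewrite mulrDl -scalerAl linearP.
- by rewrite mulrDr -scalerAr linearP.
- by rewrite linearP !mulrDl -!scalerAl scalerDr addrACA.
- by rewrite linearP !mulrDr -!scalerAr scalerDr addrACA.
rewrite -monoM !pdU -scalerAl -scalerAr -!monoM cmM natrD scalerDl.
(* [divcm] truncates exponents at 0, so the monomials to be compared are only sure to agree when
   their scalar is non-zero. *)
have eqU (a : nat) m m' : (a != 0%N -> m = m') ->
    a%:R *: mono P m = a%:R *: mono P m'.
  by case: a => [|a] mm'; rewrite ?scale0r // mm'.
congr (_ + _); apply: eqU => // mi; apply/eqP/cmP => j;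
  rewrite !(divcmE, cmM, cmU); case: (i =P j) => [<-|_]; lia.
Qed.

Lemma pd_x i j : pd i (px j) = (i == j)%:R.
Proof.
rewrite /px pdU cmU eq_sym; case: eqP => [<-|_]; last by rewrite scale0r.
rewrite scale1r -mono1; congr (mono P _); apply/eqP/cmP => l.
by rewrite divcmE cm1 subnn.
Qed.

Lemma pd1 i : pd i 1 = 0.
Proof. by rewrite -mono1 pdU cm1 scale0r. Qed.

Lemma px_pd_mono i m : px i * pd i (mono P m) = (m i)%:R *: mono P m.
Proof.
rewrite pdU -scalerAr -monoM.
have [->|mi] := eqVneq (m i) 0%N; first by rewrite !scale0r.
congr (_ *: mono P _); apply/eqP/cmP => j.
by rewrite cmM divcmE cmU; case: (i =P j) => [<-|]; lia.
Qed.

Definition coef m : P -> K^o := mext (fun m' => (m' == m)%:R : K^o).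
HB.instance Definition _ m := GRing.Linear.on (coef m).

Lemma coefU m m' : coef m (mono P m') = (m' == m)%:R.
Proof. exact: mextU. Qed.

Lemma coef_pd i f m : coef m (pd i f) = (m i).+1%:R * coef (m * ucm i)%M f.
Proof.
move: f; apply: eq_on_mono => [a u v|a u v|m'].
- by rewrite !linearP.
- by rewrite linearP mulrDr ![_ *: _]mulrCA.
rewrite pdU linearZ /= !coefU.
have [->|ne] := eqVneq m' (m * ucm i)%M.
  have -> : divcm (m * ucm i)%M (ucm i) = m.
    by apply/eqP/cmP => j; rewrite divcmE cmM addnK.
  by rewrite eqxx cmM cmUU addn1 [LHS]mulr1 mulr1.
rewrite mulr0; have [m'i|m'i] := eqVneq (m' i) 0%N; first by rewrite m'i scale0r.
case: eqP => [mE|_]; last by rewrite scaler0.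
case/eqP: ne; apply/eqP/cmP => j.
rewrite -mE cmM divcmE cmU; case: eqP => [<-|_]; lia.
Qed.

(** Recovers the finite support hidden by the sealing. One list serves every [b], so that two linear
    extensions can be compared term by term on [f]. *)
Lemma finite_coef f : exists s : seq {cmonom I},
  uniq s /\ forall V (b : {cmonom I} -> V),
    mext b f = \sum_(m <- s) coef m f *: b m.
Proof.
suff [s fE] : exists s : seq {cmonom I}, forall s', uniq s' -> {subset s <= s'} ->
    f = \sum_(m <- s') coef m f *: mono P m.
  exists (undup s); split=> [|V b]; first exact: undup_uniq.
  rewrite {1}[f](fE (undup s)) ?undup_uniq // => [|m]; last by rewrite mem_undup.
  by rewrite linear_sum; apply: eq_bigr => m _; rewrite linearZ /= mextU.
move: f; apply: mono_ind => [|a m f [s IHs]].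
  by exists nil => s' _ _; rewrite big1 // => m _; rewrite linear0 scale0r.
exists (m :: s) => s' us' ss'.
have ms' : m \in s' by apply: ss'; rewrite mem_head.
under eq_bigr => m' _ do rewrite linearP /= coefU scalerDl.
rewrite big_split /= -IHs // => [|m' m's]; last by apply: ss'; rewrite inE m's orbT.
congr (_ + _); rewrite (bigD1_seq m) //= eqxx.
rewrite big1 ?addr0 => [|m' /negPf ne]; first by congr (_ *: _); rewrite [RHS]mulr1.
by rewrite eq_sym ne scaler0 scale0r.
Qed.

Lemma coef_eq0 f : (forall m, coef m f = 0) -> f = 0.
Proof.
move=> f0; have [s [_ fE]] := finite_coef f.
have -> : f = mext (mono P) f.
  by move: {s f0 fE} f; apply: eq_on_mono => [a u v|a u v|m]; rewrite ?linearP ?mextU.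
by rewrite fE big1 // => m _; rewrite f0 scale0r.
Qed.

Lemma pd_comm i j f : pd i (pd j f) = pd j (pd i f).
Proof.
apply/eqP; rewrite -subr_eq0; apply/eqP/coef_eq0 => m.
apply/eqP; rewrite linearB subr_eq0 /=; apply/eqP.
rewrite !coef_pd !mulrA !cmM !cmU -!mulmA [(ucm j * _)%M]mulmC.
have [->//|_] := eqVneq i j.
by rewrite !addn0; congr (_ * _); apply: mulrC.
Qed.

Lemma cmonom_ind (Q : {cmonom I} -> Prop) :
  Q 1%M -> (forall i m, Q m -> Q (ucm i * m)%M) -> forall m, Q m.
Proof.
move=> Q1 QU m; have [n] := ubnP (mdeg m); elim: n m => // n IHn m lt_mn.
have [m0|] := eqVneq (finsupp m) fset0.
  suff -> : m = 1%M by [].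
  by apply/eqP; rewrite -mdeg_eq0 mdegE m0 big_seq_fset0.
case/fset0Pn => i; rewrite -cmE_neq0 => mi.
have mE : m = (ucm i * divcm m (ucm i))%M.
  by apply/eqP/cmP => j; rewrite cmM divcmE cmU; case: (i =P j) => [<-|]; lia.
by rewrite mE; apply/QU/IHn; move: lt_mn; rewrite {1}mE mdegM mdegU; lia.
Qed.

Lemma pd_eq0 f : (forall i, pd i f = 0) -> f = coef 1%M f *: 1.
Proof.
move=> df0; apply/eqP; rewrite -subr_eq0; apply/eqP/coef_eq0 => m.
rewrite -mono1 linearB linearZ /= coefU; apply/eqP; rewrite subr_eq0; apply/eqP.
elim/cmonom_ind: m => [|i m _]; first by rewrite eqxx [RHS]mulr1.
have /(congr1 (coef m)) := df0 i; rewrite coef_pd linear0 => /eqP.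
rewrite mulf_eq0 pnatr_eq0 /= mulmC => /eqP ->.
by rewrite eq_sym cmM_eq1 cm1_eq1 scaler0.
Qed.

Lemma px_linear_ext (X : P -> P) : linear X ->
  (forall i f, X (px i * f) = px i * X f) -> forall f, X f = f * X 1.
Proof.
move=> linX Xx; apply: eq_on_mono => // [a f g|m].
  by rewrite mulrDl scalerAl.
elim/cmonom_ind: m => [|i m IHm]; first by rewrite mono1 mul1r.
by rewrite monoM Xx IHm mulrA.
Qed.

Lemma coef_px0 i f : coef 1%M (px i * f) = 0.
Proof.
move: f; apply: eq_on_mono => [a u v|a u v|m].
- by rewrite mulrDr -scalerAr linearP.
- by rewrite scaler0 addr0.
by rewrite -monoM coefU cmM_eq1 cm1_eq1.
Qed.

Lemma pd_bounded f : exists s : seq I, forall i, i \notin s -> pd i f = 0.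
Proof.
move: f; apply: mono_ind => [|a m f [s IHs]].
  by exists nil => i _; rewrite linear0.
exists (enum_fset (finsupp m) ++ s) => i; rewrite mem_cat negb_or => /andP[im si].
rewrite linearP /= IHs // addr0 pdU; have /eqP -> : m i == 0%N by rewrite cmE_eq0.
by rewrite scale0r scaler0.
Qed.

(** The substitution [x_n := p] with [p] kept as an indeterminate. *)
Definition diagev : P -> {poly K} := mext (fun m => 'X^(mdeg m)).
HB.instance Definition _ := GRing.Linear.on diagev.

Lemma diagevM f g : diagev (f * g) = diagev f * diagev g.
Proof.
move: f g; apply: eq_on_mono2 => [g a f f'|f a g g'|g a f f'|f a g g'|m1 m2].
- by rewrite mulrDl -scalerAl linearP.
- by rewrite mulrDr -scalerAr linearP.
- by rewrite linearP mulrDl -scalerAl.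
- by rewrite linearP mulrDr -scalerAr.
by rewrite -monoM /diagev !mextU mdegM exprD.
Qed.

Lemma diagev_x i : diagev (px i) = 'X.
Proof. by rewrite /diagev mextU mdegU. Qed.

Lemma diagev1 : diagev 1 = 1.
Proof. by rewrite -mono1 /diagev mextU mdeg1. Qed.

End PolynomialAlgebra.

(** * The Fock space and the Sugawara operators *)

Section Fock.
Variables (K : numFieldType) (k : K).
Local Notation F := (polyalg K nat).
Implicit Types (f g : F) (m n i j : int).

(* The modes [b_n]; the variable [x_{s+1}] is [px s], so that [b_{-(s+1)}], where
   [- (s+1) = Negz s], is the multiplication by [px s]. *)
Definition heis n f : F :=
  match n with
  | Posz 0 => k *: f
  | Posz s.+1 => (s.+1%:R / 2) *: pd s f
  | Negz s => px K s * f
  end.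

Fact heis_linear n : linear (heis n).
Proof.
move=> a f g; case: n => [[|s]|s] /=.
- by rewrite scalerDr !scalerA mulrC.
- by rewrite linearP scalerDr !scalerA mulrC.
- by rewrite mulrDr -scalerAr.
Qed.
HB.instance Definition _ n := GRing.isLinear.Build K F F _ (heis n) (heis_linear n).

Lemma heisZ n a f : heis n (a *: f) = a *: heis n f.
Proof. exact: linearZ. Qed.

Lemma heis_comm m n f :
  heis m (heis n f) - heis n (heis m f)
  = (if m + n == 0 then m%:~R / 2 else 0) *: f.
Proof.
have pdpx s t : pd s (px K t * f) = (s == t)%:R *: f + px K t * pd s f.
  rewrite pdM pd_x; case: eqP => _; last by rewrite mul0r scale0r.
  by rewrite mul1r scale1r.
have if0 (b : bool) a : (if b then a else 0) = b%:R * a :> K.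
  by case: b; rewrite ?mul1r ?mul0r.
rewrite if0; case: m n => [[|s]|s] [[|t]|t]; rewrite /heis.
- by rewrite subrr ?mul0r ?mulr0 scale0r.
- by rewrite pdZ !scalerA [k * _]mulrC subrr ?mul0r ?mulr0 scale0r.
- by rewrite -scalerAr subrr ?mul0r ?mulr0 scale0r.
- by rewrite pdZ !scalerA [k * _]mulrC subrr ?mul0r ?mulr0 scale0r.
- by rewrite !pdZ !scalerA [X in X *: _]mulrC pd_comm subrr ?mul0r ?mulr0 scale0r.
- rewrite pdpx scalerDr -scalerAr addrK scalerA NegzE subr_eq0 eqz_nat eqSS.
  by rewrite mulrC.
- by rewrite -scalerAr subrr ?mul0r ?mulr0 scale0r.
- rewrite pdpx scalerDr opprD -scalerAr addrCA subrr addr0 scalerA -scaleNr.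
  rewrite NegzE addrC subr_eq0 eqz_nat eqSS [t == s]eq_sym.
  case: eqP => [->|_]; last by rewrite mulr0 oppr0 mul0r.
  by rewrite mulr1 mul1r rmorphN mulNr.
- by rewrite mulrCA subrr ?mul0r ?mulr0 scale0r.
Qed.

Lemma heis_bounded f : exists N : nat, forall n, N%:Z < n -> heis n f = 0.
Proof.
have [s sf] := pd_bounded f; exists (\max_(i <- s) i.+1) => -[[|n]|n] //= lt_n.
rewrite sf ?scaler0 //; apply: contraTN lt_n => ns; rewrite -leNgt lez_nat.
exact: (leq_bigmax_seq (F := succn)).
Qed.

Definition fbd f : nat := projT1 (cid (heis_bounded f)).

Lemma heis_gt_fbd n f : (fbd f)%:Z < n -> heis n f = 0.
Proof. by rewrite /fbd; case: cid => /= N; apply. Qed.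

Definition nord i j f : F :=
  if i <= j then heis i (heis j f) else heis j (heis i f).

Lemma nordC i j f : nord i j f = nord j i f.
Proof. by rewrite /nord; case: ltgtP => // ->. Qed.

Fact nord_linear i j : linear (nord i j).
Proof. by move=> a f g; rewrite /nord; case: ifP => _; rewrite !linearP. Qed.
HB.instance Definition _ i j := GRing.isLinear.Build K F F _ (nord i j) (nord_linear i j).

Lemma nord_gt_fbd i j f : (fbd f)%:Z < i \/ (fbd f)%:Z < j -> nord i j f = 0.
Proof.
move=> ij; rewrite /nord; case: leP => le_ij.
  by rewrite (@heis_gt_fbd j) ?linear0 //; lia.
by rewrite (@heis_gt_fbd i) ?linear0 //; lia.
Qed.

(* [L_m = sum_i :b_i b_{m-i}:] is a locally finite sum over [int]; [sug] truncates
   it to a range depending on [f], and any larger range gives the same value. *)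
Definition psug (a : int) (len : nat) m f : F :=
  \sum_(s < len) nord (a + s%:Z) (m - (a + s%:Z)) f.

Lemma psug_cat a p q m f :
  psug a (p + q) m f = psug a p m f + psug (a + p%:Z) q m f.
Proof.
rewrite /psug big_split_ord /=; congr (_ + _); apply: eq_bigr => s _.
by rewrite PoszD addrA.
Qed.

Definition sug m f : F :=
  psug (- (fbd f + `|m|)%:Z) (fbd f + `|m|).*2.+1 m f.

Lemma sugE m f a len : (fbd f + `|m|)%:Z <= - a ->
  (fbd f + `|m|)%:Z < a + len%:Z -> sug m f = psug a len m f.
Proof.
rewrite /sug; set B := (_ + _)%N => aB lB.
have [p pE] : exists p : nat, a + p%:Z = - B%:Z by exists `|- B%:Z - a|%N; lia.
have -> : len = (p + (B.*2.+1 + (len - p - B.*2.+1)))%N by lia.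
rewrite !psug_cat pE [psug a _ _ _]big1 => [|s _].
  rewrite add0r [X in _ + X]big1 ?addr0 // => s _.
  by apply: nord_gt_fbd; move: (ltn_ord s); lia.
by apply: nord_gt_fbd; move: (ltn_ord s); lia.
Qed.

Lemma sug_sym m f B : (fbd f + `|m|)%N%:Z < B%:Z ->
  sug m f = psug (- B%:Z) B.*2.+1 m f.
Proof. by move=> ?; apply: sugE; lia. Qed.

Fact sug_linear m : linear (sug m).
Proof.
move=> a f g; pose B := (fbd f + fbd g + fbd (a *: f + g) + `|m|).+1.
rewrite !(@sug_sym m _ B); try by lia.
rewrite /psug scaler_sumr -big_split; apply: eq_bigr => s _ /=.
by rewrite linearP.
Qed.
HB.instance Definition _ m := GRing.isLinear.Build K F F _ (sug m) (sug_linear m).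

(** The two orders of [b_i b_j] differ by a scalar, so normal ordering leaves no trace in a
    commutator with [b_n]. *)
Lemma nord_comm i j n f : nord i j (heis n f) - heis n (nord i j f)
  = (if i + n == 0 then i%:~R / 2 else 0) *: heis j f
    + (if j + n == 0 then j%:~R / 2 else 0) *: heis i f.
Proof.
have comm2 p q : heis p (heis q (heis n f)) - heis n (heis p (heis q f))
    = (if p + n == 0 then p%:~R / 2 else 0) *: heis q f
      + (if q + n == 0 then q%:~R / 2 else 0) *: heis p f.
  rewrite -(heis_comm p) -heisZ -heis_comm linearB /=.
  by rewrite [RHS]addrC addrA addrNK.
by rewrite /nord; case: ifP => _; rewrite comm2 // addrC.
Qed.

Lemma sug_comm m n f : sug m (heis n f) - heis n (sug m f) = - n%:~R *: heis (m + n) f.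
Proof.
pose B := (fbd f + fbd (heis n f) + `|m| + `|n|).+1.
rewrite !(@sug_sym m _ B); try by lia.
rewrite /psug linear_sum -sumrB /=.
under eq_bigr => s _ do rewrite nord_comm.
rewrite big_split /=.
have sel (i0 : int) (G : int -> F) : `|i0|%N%:Z <= B%:Z ->
    \sum_(s < B.*2.+1) (if - B%:Z + s%:Z == i0 then G (- B%:Z + s%:Z) else 0) = G i0.
  move=> iB; have sP : (absz (i0 + B%:Z)%R < B.*2.+1)%N by lia.
  rewrite (bigD1 (Ordinal sP)) //= big1 => [|s].
    have -> : - B%:Z + (absz (i0 + B%:Z)%R)%:Z = i0 by lia.
    by rewrite eqxx addr0.
  by move=> ne_s; case: eqP => // E; case/eqP: ne_s; apply: val_inj => /=; lia.
(* The indices [i = - n] and [m - i = - n] contribute one half each. *)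
have -> : - n%:~R = (- n)%:~R / 2 + (- n)%:~R / 2 :> K.
  by rewrite -splitr rmorphN.
rewrite scalerDl; congr (_ + _).
  rewrite -[RHS](sel (- n) (fun i => ((- n)%:~R / 2) *: heis (m + n) f)); last by lia.
  apply: eq_bigr => s _; rewrite -addr_eq0.
  case: eqP => [E|_]; last by rewrite scale0r.
  by congr ((_%:~R / 2) *: heis _ f); lia.
rewrite -[RHS](sel (m + n) (fun i => ((- n)%:~R / 2) *: heis (m + n) f)); last by lia.
apply: eq_bigr => s _.
have -> : (m - (- B%:Z + s%:Z) + n == 0) = (- B%:Z + s%:Z == m + n) by lia.
case: eqP => [E|_]; last by rewrite scale0r.
by congr ((_%:~R / 2) *: heis _ f); lia.
Qed.

End Fock.

(** * The Virasoro relations on the Fock space, with central charge 1 *)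

Section FockVirasoro.
Variables (K : numFieldType) (k : K).
Local Notation F := (polyalg K nat).
Local Notation heis := (heis k).
Local Notation nord := (nord k).
Local Notation psug := (psug k).
Local Notation sug := (sug k).
Local Notation fbd := (fbd k).
Local Notation aug := (coef (I := nat) 1%M).
Implicit Types (f g : F) (m n i j : int).

Lemma nordE i j f : i + j != 0 -> nord i j f = heis i (heis j f).
Proof.
rewrite /nord; case: ifP => // _ /negPf ij.
by apply/eqP; rewrite eq_sym -subr_eq0 heis_comm ij scale0r.
Qed.

Lemma nordE_le i j f : i <= j -> nord i j f = heis i (heis j f).
Proof. by rewrite /nord => ->. Qed.

(* [M = 2 a + p] packs the two cases [M = p, a = 0] and [M = - p, a = - p]. *)
Lemma sug_split M a (p B : nat) f :
    M = a + a + p%:Z -> a = 0 \/ a = - p%:Z -> (fbd f + p < B)%N ->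
  sug M f = \sum_(u < p.+1) nord (a + u%:Z) (M - (a + u%:Z)) f
    + 2 *: \sum_(l < B) nord (a + p%:Z + 1 + l%:Z) (a - 1 - l%:Z) f.
Proof.
move=> ME a0p ltB; rewrite (@sugE _ _ _ _ (a - B%:Z) (B + (p.+1 + B))); try lia.
rewrite !psug_cat addrC -addrA.
have -> : a - B%:Z + B%:Z = a by lia.
rewrite {1}/psug; congr (_ + _); rewrite scaler_nat mulr2n; congr (_ + _).
  by apply: eq_bigr => l _; congr (nord _ _ _); lia.
rewrite /psug (reindex_inj rev_ord_inj); apply: eq_bigr => l _ /=.
rewrite nordC; congr (nord _ _ _); have := ltn_ord l; lia.
Qed.

Lemma sug_pos (p B : nat) f : (fbd f + p < B)%N ->
  sug p f = \sum_(u < p.+1) heis u%:Z (heis (p%:Z - u%:Z) f)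
    + 2 *: \sum_(l < B) heis (Negz l) (heis (p + l.+1)%N f).
Proof.
move=> ltB; rewrite (@sug_split _ 0 p B); [|by lia|by left|by []].
congr (_ + _ *: _); apply: eq_bigr => u _; last first.
  by rewrite nordC nordE_le; [congr (heis _ (heis _ f)); lia|lia].
have [p0|p0] := eqVneq p 0%N.
  by rewrite nordE_le; [congr (heis _ (heis _ f)); lia|have := ltn_ord u; lia].
by rewrite nordE; [congr (heis _ (heis _ f)); lia|lia].
Qed.

Lemma sug_neg (p B : nat) f : (fbd f + p < B)%N ->
  sug (- p%:Z) f = \sum_(u < p.+1) heis (- u%:Z) (heis (u%:Z - p%:Z) f)
    + 2 *: \sum_(l < B) heis (Negz (p + l)) (heis l.+1 f).
Proof.
move=> ltB; rewrite (@sug_split _ (- p%:Z) p B); [|by lia|by right|by []].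
congr (_ + _ *: _); last first.
  apply: eq_bigr => u _.
  by rewrite nordC nordE_le; [congr (heis _ (heis _ f)); lia|lia].
rewrite (reindex_inj rev_ord_inj); apply: eq_bigr => u _ /=.
have lt_up := ltn_ord u.
have [p0|p0] := eqVneq p 0%N.
  by rewrite nordE_le; [congr (heis _ (heis _ f)); lia|lia].
by rewrite nordE; [congr (heis _ (heis _ f)); lia|lia].
Qed.

Lemma heis1_pos n : 0 < n -> heis n 1 = 0.
Proof. by case: n => [[|s]|s] //= _; rewrite pd1 scaler0. Qed.

Lemma sug1_pos n : 0 < n -> sug n 1 = 0.
Proof.
move=> n0; rewrite /sug /psug big1 // => s _; rewrite /nord.
case: ifP => ij; rewrite heis1_pos ?linear0 //; lia.
Qed.

Lemma sug1_neg (p : nat) :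
  sug (- p%:Z) 1 = \sum_(u < p.+1) heis (- u%:Z) (heis (u%:Z - p%:Z) 1).
Proof.
rewrite (sug_neg (ltnSn _)) [X in _ *: X]big1 ?scaler0 ?addr0 // => l _.
by rewrite heis1_pos ?linear0.
Qed.

Lemma sug1_0 : sug 0 1 = k ^+ 2 *: 1.
Proof. by rewrite -[0]oppr0 (sug1_neg 0) big_ord1 /= scalerA. Qed.

Lemma aug_heis_neg n f : n < 0 -> aug (heis n f) = 0.
Proof. by case: n => // s _; apply: coef_px0. Qed.

Lemma aug_heis1 n : aug (heis n 1) = if n == 0 then k else 0.
Proof.
case: ltgtP => [n0|n0|->]; [exact: aug_heis_neg|by rewrite heis1_pos ?linear0|].
by rewrite /= linearZ /= -mono1 coefU eqxx [LHS]mulr1.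
Qed.

Lemma aug_sug_neg m f : m < 0 -> aug (sug m f) = 0.
Proof.
move=> m0; rewrite /sug /psug linear_sum big1 // => s _ /=; rewrite /nord.
case: ifP => ij; apply: aug_heis_neg; lia.
Qed.

Lemma aug_sug0 f : aug (sug 0 f) = k ^+ 2 * aug f.
Proof.
rewrite -[0]/(Posz 0) (sug_pos (ltnSn _)) linearD.
rewrite [X in _ + X]linearZ /= [X in _ + _ *: X]linear_sum /=.
rewrite [X in _ *: X]big1 => [|l _]; last by rewrite coef_px0.
by rewrite /= scaler0 addr0 big_ord1 /= scalerA linearZ /= expr2.
Qed.

Lemma sum_mulB (q : nat) (a : K) :
  \sum_(u < q) u%:R * (a - u%:R)
  = a * (q%:R * (q%:R - 1)) / 2 - q%:R * (q%:R - 1) * (2 * q%:R - 1) / 6.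
Proof.
elim: q => [|q IHq]; first by rewrite big_ord0; field.
by rewrite big_ord_recr /= IHq -natr1; field.
Qed.

Lemma augZ a f : aug (a *: f) = a * aug f.
Proof. exact: linearZ. Qed.

Lemma augB f g : aug (f - g) = aug f - aug g.
Proof. exact: linearB. Qed.

Lemma augD f g : aug (f + g) = aug f + aug g.
Proof. exact: linearD. Qed.

Lemma aug1 : aug (1 : F) = 1.
Proof. by rewrite -mono1 coefU eqxx. Qed.

Lemma sugB m f g : sug m (f - g) = sug m f - sug m g.
Proof. exact: linearB. Qed.

Lemma sugZ m a f : sug m (a *: f) = a *: sug m f.
Proof. exact: linearZ. Qed.

Lemma sug0 m : sug m 0 = 0.
Proof. exact: linear0. Qed.

Lemma heisB n f g : heis n (f - g) = heis n f - heis n g.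
Proof. exact: linearB. Qed.

Lemma sug_heis m n f : sug m (heis n f) = heis n (sug m f) - n%:~R *: heis (m + n) f.
Proof. by rewrite -scaleNr -sug_comm addrC subrK. Qed.

(** The central charge is found here. Moving [L_m] past [b_{-u}] in [b_{-u} b_{u-p}] leaves
    [u b_{m-u} b_{u-p}]. For [m = p] and [0 < u < p] its vacuum coefficient is [u (m - u) / 2], and
    these add up to [(m^3 - m) / 12]; the ends [u = 0] and [u = p] give [m k^2] each. *)
Lemma aug_sug_sug (m p : nat) : (0 < m)%N -> (0 < p)%N ->
  aug (sug m (sug (- p%:Z) 1))
  = if m == p then 2 * m%:R * k ^+ 2 + (m%:R ^+ 3 - m%:R) / 12 else 0.
Proof.
move=> m0 p0; rewrite sug1_neg [sug _ _]linear_sum linear_sum /=.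
have term (u : nat) : (u <= p)%N ->
    aug (sug m (heis (- u%:Z) (heis (u%:Z - p%:Z) 1)))
    = (m == p)%:R * (u%:R * (m%:R - u%:R) / 2
                     + ((u == 0) + (u == p))%:R * (m%:R * k ^+ 2)).
  have mp (a : K) : (if m%:Z - p%:Z == 0 then a else 0) = (m == p)%:R * a.
    by rewrite subr_eq0 eqz_nat; case: eqP; rewrite ?mul1r ?mul0r.
  case: u => [|u] le_up.
    rewrite oppr0 sub0r [heis 0 _]/= linearZ /= augZ sug_heis.
    rewrite sug1_pos ?ltz_nat // linear0 sub0r -scaleNr augZ aug_heis1 mp.
    rewrite [0%N == p]eq_sym (gtn_eqF p0) mulrNz opprK -pmulrn.
    by case: (m =P p) => [->|_] /=; rewrite ?addn0; ring.
  rewrite sug_heis augB aug_heis_neg // sub0r augZ.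
  rewrite -mulNr mulrNz opprK -pmulrn; have [up|up] := eqVneq u.+1 p.
    rewrite up subrr [heis 0 _]/= heisZ augZ aug_heis1 mp (gtn_eqF p0) /=.
    by case: (m =P p) => [->|_] /=; ring.
  have up0 : u.+1%:Z - p%:Z < 0 by lia.
  have -> : heis (m%:Z - u.+1%:Z) (heis (u.+1%:Z - p%:Z) 1)
      = heis (u.+1%:Z - p%:Z) (heis (m%:Z - u.+1%:Z) 1)
        + (if m%:Z - p%:Z == 0 then (m%:Z - u.+1%:Z)%:~R / 2 else 0) *: 1.
    rewrite [RHS]addrC; apply/eqP; rewrite -subr_eq heis_comm; apply/eqP.
    by have -> : m%:Z - u.+1%:Z + (u.+1%:Z - p%:Z) = m%:Z - p%:Z by ring.
  rewrite augD aug_heis_neg // add0r augZ mp aug1 rmorphB /= -!pmulrn.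
  by rewrite mul0r addr0; ring.
rewrite (eq_bigr _ (fun (u : 'I_p.+1) _ => term u (ltn_ord u))).
rewrite -mulr_sumr; case: eqP => [mp|_]; last by rewrite mul0r.
rewrite mul1r big_split /= -mulr_suml sum_mulB -mulr_suml -natr_sum big_split /=.
rewrite big_ord_recl big1 // big_ord_recr /= big1 ?eqxx => [|u _]; last first.
  by rewrite (ltn_eqF (ltn_ord u)).
by rewrite mp -natr1 (_ : (1 + 0 + (0 + true))%N = 2%N) //; field.
Qed.

(* The difference of the two sides commutes with all the [b_n], so it is a scalar,
   which is computed on the vacuum. *)
Lemma vir_fock m n f : sug m (sug n f) - sug n (sug m f)
  = (m - n)%:~R *: sug (m + n) f
    + (if m + n == 0 then (m ^+ 3 - m)%:~R / 12 else 0) *: f.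
Proof.
pose X f := sug m (sug n f) - sug n (sug m f) - (m - n)%:~R *: sug (m + n) f.
rewrite [RHS]addrC; apply/eqP; rewrite -subr_eq -/(X f); apply/eqP.
have linX : linear X.
  move=> a u v; rewrite /X !sug_linear linB_arr [_%:~R *: _]scalerDr scalerA [_ * a]mulrC.
  by rewrite -scalerA linB_arr.
have X_heis l g : X (heis l g) = heis l (X g).
  have sug2 p q : sug p (sug q (heis l g)) = heis l (sug p (sug q g))
      - l%:~R *: heis (p + l) (sug q g) - l%:~R *: heis (q + l) (sug p g)
      + (l * (q + l))%:~R *: heis (p + q + l) g.
    rewrite sug_heis sugB sugZ !sug_heis scalerBr scalerA -intrM opprB.
    by rewrite addrA addrA addrAC.
  rewrite /X !heisB heisZ [sug (m + n) _]sug_heis scalerBr scalerA !sug2 -intrM [n + m]addrC.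
  have -> : (m - n) * l = l * (m + l) - l * (n + l) by ring.
  rewrite [(l * _ - _)%:~R]intrB !scalerBl; ring.
have X1 : X 1 = aug (X 1) *: 1.
  apply: pd_eq0 => i; apply/eqP; have : heis i.+1%:Z (X 1) = 0.
    by rewrite -X_heis heis1_pos // /X !sug0 scaler0 !subr0.
  by move/eqP; rewrite /= scaler_eq0 mulf_eq0 invr_eq0 !pnatr_eq0.
rewrite (px_linear_ext linX (fun s => X_heis (Negz s))) X1 -scalerAr mulr1.
congr (_ *: _); rewrite /X !augB augZ.
have aug1k l : aug (sug l 1) = if l == 0 then k ^+ 2 else 0.
  case: ltgtP => [l0|l0|->]; first exact: aug_sug_neg.
    by rewrite sug1_pos ?linear0.
  by rewrite aug_sug0 aug1 mulr1.
rewrite aug1k; clear X linX X_heis X1; case: m n => [[|m]|m] [[|n]|n].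
- by have -> : 0%:Z ^+ 3 - 0%:Z = 0 by []; rewrite !subrr !mul0r subr0.
- by rewrite aug_sug0 sug1_0 sugZ augZ !aug1k /= !mulr0 !subr0.
- by rewrite aug_sug0 sug1_0 sugZ augZ !aug1k /= !mulr0 !subr0.
- by rewrite aug_sug0 sug1_0 sugZ augZ !aug1k /= !mulr0 !subr0.
- by rewrite !sug1_pos // !sug0 linear0 !mulr0 !subr0.
- rewrite [X in _ - X - _]aug_sug_neg // subr0 NegzE aug_sug_sug // eqSS.
  rewrite subr_eq0 eqz_nat eqSS; case: eqP => [->|_]; last by rewrite mulr0 subr0.
  by rewrite opprK !(intrD, intrB, rmorphXn) /= -!pmulrn; ring.
- by rewrite aug_sug0 sug1_0 sugZ augZ !aug1k /= !mulr0 !subr0.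
- rewrite aug_sug_neg // sub0r NegzE aug_sug_sug // eqSS.
  have -> : (- m.+1%:Z + n.+1%:Z == 0) = (n == m) by lia.
  case: eqP => [->|_]; last by rewrite mulr0 subr0 oppr0.
  by rewrite !(intrD, intrB, rmorphXn, mulrNz) /= -!pmulrn; field.
- by rewrite !aug_sug_neg // mulr0 !subr0.
Qed.

End FockVirasoro.

(** * The Hermitian form *)

Section FockRep.
Variables (K : numFieldType) (k : K).
Local Notation F := (polyalg K nat).

Definition fock_basis (f : F) (i : option int) : F :=
  if i is Some n then sug k n f else f.

Definition fock_act (x : vir K) (f : F) : F := lext (fock_basis f) x.

Lemma fock_actL n f : fock_act (L n) f = sug k n f.
Proof. exact: lextU. Qed.

Lemma fock_actC f : fock_act C f = f.
Proof. exact: lextU. Qed.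

Fact fock_linl a (x y : vir K) f :
  fock_act (a *: x + y) f = a *: fock_act x f + fock_act y f.
Proof. exact: lext_lin. Qed.

Fact fock_linr a (x : vir K) f g :
  fock_act x (a *: f + g) = a *: fock_act x f + fock_act x g.
Proof.
move: x; apply: lin_ext => [b x y|b x y|[n|]].
- exact: fock_linl.
- by rewrite !fock_linl !scalerDr !scalerA mulrC addrACA.
- by rewrite !fock_actL sug_linear.
- by rewrite !fock_actC.
Qed.

Fact fock_lie (x y : vir K) f : fock_act (lie x y) f
  = fock_act x (fock_act y f) - fock_act y (fock_act x f).
Proof.
move: x; apply: lin_ext => [a u u'|a u u'|i].
- by rewrite lie_linl fock_linl.
- by rewrite !(fock_linl, fock_linr) linB_arr.
move: y; apply: lin_ext => [a u u'|a u u'|j].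
- by rewrite lie_linr fock_linl.
- by rewrite !(fock_linl, fock_linr) linB_arr.
rewrite -[lie _ _]/(vir_lie _ _) vir_lieE.
have act0 : fock_act 0 f = 0.
  by have := fock_linl (-1) 0 0 f; rewrite scaler0 addr0 scaleN1r addNr.
case: i j => [m|] [n|]; last 3 first.
- by rewrite [vir_bracket _ _]/= act0 -[<< None >>]/C !fock_actC subrr.
- by rewrite [vir_bracket _ _]/= act0 -[<< None >>]/C !fock_actC subrr.
- by rewrite [vir_bracket _ _]/= act0 -[<< None >>]/C !fock_actC subrr.
rewrite -[<< Some m >>]/(L m) -[<< Some n >>]/(L n) 4!fock_actL vir_fock.
rewrite [vir_bracket _ _]/= fock_linl fock_actL.
congr (_ + _); case: eqP => _; last by rewrite act0 scale0r.
by rewrite -[_ *: C]addr0 fock_linl act0 addr0 fock_actC.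
Qed.

Definition fock_rep : lieRep (vir K) F := LieRep fock_linl fock_linr fock_lie.
End FockRep.

Lemma U1_act_gen (K : numFieldType) (M : lmodType K) (rho : lieRep (vir K) M)
    (x : lower K 0) u m :
  U1_act rho (ugen x * u) m = rho (lower_val x) (U1_act rho u m).
Proof. by rewrite /U1_act uactM uact_gen. Qed.

Lemma U1_act_linl (K : numFieldType) (M : lmodType K) (rho : lieRep (vir K) M)
    a u v m :
  U1_act rho (a *: u + v) m = a *: U1_act rho u m + U1_act rho v m.
Proof. exact: uact_linl. Qed.

Lemma U1_act0 (K : numFieldType) (M : lmodType K) (rho : lieRep (vir K) M) m :
  U1_act rho 0 m = 0.
Proof.
by have := U1_act_linl rho (-1) 0 0 m; rewrite scaler0 addr0 scaleN1r addNr.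
Qed.

(** The degree in [homogeneousM] is an arbitrary natural number; its positivity comes from the
    support condition that defines [lower K 0]. *)
Lemma lower_gen_gt0 (K : numFieldType) (x : lower K 0) (n : nat) :
  lower_val x = L (- n%:Z) -> (0 < n)%N.
Proof.
case: x => x /= /lower_spanP sx xE; have /sx : x@_(Some (- n%:Z)) != 0.
  by rewrite xE mcoeffUU oner_eq0.
by lia.
Qed.

Section Form.
Variables (K : numClosedFieldType) (k : K).
Hypothesis k_real : k^* = k.
Local Notation F := (polyalg K nat).
Implicit Types (f g : F) (m : {cmonom nat}) (i j : int).

(** The squared lengths forced by making [b_{-n}] and [b_n] adjoint, starting from 1 on the
    vacuum. *)
Definition mono_norm m : K :=
  \prod_(s <- finsupp m) ((s.+1%:R / 2) ^+ m s * (m s)`!%:R).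

Lemma mono_norm_gt0 m : 0 < mono_norm m.
Proof.
apply: prodr_gt0 => s _; rewrite mulr_gt0 ?exprn_gt0 ?divr_gt0 ?ltr0n //.
exact: fact_gt0.
Qed.

Lemma mono_normU s m :
  mono_norm (ucm s * m)%M = mono_norm m * (s.+1%:R / 2 * (m s).+1%:R).
Proof.
pose d := (s |` finsupp m)%fset.
have normE m' : (finsupp m' `<=` d)%fset ->
    mono_norm m' = \prod_(t <- d) ((t.+1%:R / 2) ^+ m' t * (m' t)`!%:R).
  move=> sub; apply: big_fset_incl => // t _; rewrite -cmE_eq0 => /eqP ->.
  by rewrite expr0 mul1r.
rewrite !normE; last 2 first.
- by rewrite fsubsetUr.
- by rewrite mdomD mdomU.
have sd : s \in d by rewrite in_fset1U eqxx.
rewrite !(big_fsetD1 s sd) /= cmM cmUU add1n factS natrM exprS.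
set G := \prod_(t <- _) _; set H := \prod_(t <- _) _.
have -> : G = H.
  apply: eq_big_seq => t; rewrite in_fsetD1 => /andP[ts _].
  by rewrite cmM cmU eq_sym (negPf ts).
move: H (s.+1%:R / 2) ((m s)`!%:R) ((m s).+1%:R) => h a b c.
by move: (a ^+ m s) => e; ring.
Qed.

Definition form f : F -> K^o := mext (fun m => mono_norm m * (coef m f)^* : K^o).
HB.instance Definition _ f := GRing.Linear.on (form f).

Lemma formP f a g g' : form f (a *: g + g') = a * form f g + form f g'.
Proof. exact: linearP. Qed.

Lemma formU f m : form f (mono F m) = mono_norm m * (coef m f)^*.
Proof. exact: mextU. Qed.

Lemma formDl f f' g : form (f + f') g = form f g + form f' g.
Proof.
move: g; apply: eq_on_mono => [a u v|a u v|m].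
- by rewrite !linearP.
- by rewrite !linearP /= scalerDr addrACA.
by rewrite !formU linearD /= rmorphD mulrDr.
Qed.

Lemma formZl a f g : form (a *: f) g = a^* * form f g.
Proof.
move: g; apply: eq_on_mono => [b u v|b u v|m].
- by rewrite !linearP.
- by rewrite formP mulrDr mulrCA.
by rewrite !formU linearZ /= rmorphM mulrCA.
Qed.

Lemma form0l g : form 0 g = 0.
Proof. by rewrite -[0](scale0r 0) formZl rmorph0 mul0r. Qed.

Lemma form_suml (I : finType) (f : I -> F) g :
  form (\sum_i f i) g = \sum_i form (f i) g.
Proof. exact: (big_morph (form^~ g) (fun f f' => formDl f f' g) (form0l g)). Qed.

Lemma form_eq0 f : form f f = 0 -> f = 0.
Proof.
have [s [us fE]] := finite_coef f; rewrite /form fE => /eqP.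
have -> : \sum_(m <- s) coef m f *: (mono_norm m * (coef m f)^* : K^o)
    = \sum_(m <- s) mono_norm m * `|coef m f| ^+ 2.
  by apply: eq_bigr => m _; rewrite normCK; apply: mulrCA.
rewrite psumr_eq0 => [/allP f0|m _]; last first.
  by rewrite mulr_ge0 ?exprn_ge0 // ltW ?mono_norm_gt0.
apply: coef_eq0 => m; rewrite {1}/coef fE big_seq big1 // => m' m's.
have := f0 _ m's; rewrite /= mulf_eq0 gt_eqF ?mono_norm_gt0 // sqrf_eq0 normr_eq0.
by move=> /eqP ->; rewrite scale0r.
Qed.

Lemma coef_px s m f :
  coef m (px K s * f) = if m s == 0%N then 0 else coef (divcm m (ucm s)) f.
Proof.
move: f; apply: eq_on_mono => [a u v|a u v|m'].
- by rewrite mulrDr -scalerAr linearP.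
- by case: eqP; rewrite ?scaler0 ?addr0 // linearP.
rewrite -monoM !coefU; have [ms|ms] := eqVneq (m s) 0%N.
  case: eqP => // E; move: ms; rewrite -E cmM cmUU; lia.
congr (nat_of_bool _)%:R; apply/eqP/eqP => [<-|->].
  by apply/eqP/cmP => t; rewrite divcmE cmM addKn.
by apply/eqP/cmP => t; rewrite cmM divcmE cmU; case: (s =P t) => [<-|]; lia.
Qed.

Lemma form_heis i f g : form (heis k i f) g = form f (heis k (- i) g).
Proof.
have half s : (s.+1%:R / 2 : K)^* = s.+1%:R / 2 by rewrite fmorph_div !rmorph_nat.
case: i => [[|s]|s].
- by rewrite /= formZl k_real linearZ.
- rewrite [heis _ _ f]/= [heis _ _ g]/= formZl half.
  move: g; apply: eq_on_mono => [a u v|a u v|m].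
  + by rewrite formP mulrDr mulrCA.
  + by rewrite mulrDr -scalerAr formP.
  rewrite -monoM !formU coef_pd mono_normU mulmC rmorphM rmorph_nat; ring.
rewrite NegzE opprK [heis _ _ f]/= [heis _ _ g]/=.
move: g; apply: eq_on_mono => [a u v|a u v|m].
- by rewrite formP.
- by rewrite pdP scalerDr scalerA [_ * a]mulrC -(scalerA a) formP.
rewrite pdU formU coef_px !linearZ /= formU.
have [ms|ms] := eqVneq (m s) 0%N; first by rewrite ms scale0r scaler0 rmorph0 mulr0.
have {1}-> : m = (ucm s * divcm m (ucm s))%M.
  by apply/eqP/cmP => t; rewrite cmM divcmE cmU; case: (s =P t) => [<-|]; lia.
rewrite mono_normU divcmE cmUU subn1 prednK ?lt0n //.
have alg (a b c e : K) : a * (b * c) * e = b * (c * (a * e)) by ring.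
exact: alg.
Qed.

Lemma form_sug i f g : form (sug k i f) g = form f (sug k (- i) g).
Proof.
pose B := (fbd k f + fbd k g + `|i|).+1.
rewrite !(@sug_sym _ _ _ _ B); try lia.
(* Reversing the symmetric range exchanges [i] and [- i], as taking adjoints of the modes does. *)
rewrite /psug form_suml linear_sum (reindex_inj rev_ord_inj).
apply: eq_bigr => s _ /=; have lt_s := ltn_ord s.
have form_nord a b : form (nord k a b f) g = form f (nord k (- a) (- b) g).
  rewrite [in RHS]nordC /nord lerN2; case: ifP => _; rewrite !form_heis //.
rewrite form_nord; congr (form f (nord k _ _ g)); lia.
Qed.

(** In positive degree each term starts with some [L_{-n}], [n > 0]; its adjoint [L_n] kills [g]. *)
Lemma form_homogeneous d u w g : (0 < d)%N -> homogeneous d u ->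
    (forall n : nat, (0 < n)%N -> sug k n g = 0) ->
  form (U1_act (fock_rep k) u w) g = 0.
Proof.
move=> d0 hu g0; elim: hu d0 => {d u} [//|d _|d a u v _ IHu _ IHv d0|d n x u xE _ _ _].
- by rewrite U1_act0 form0l.
- by rewrite U1_act_linl formDl formZl IHu ?IHv // mulr0 addr0.
rewrite U1_act_gen xE /= fock_actL form_sug opprK g0 ?linear0 //.
exact: lower_gen_gt0 xE.
Qed.

End Form.

(** * Singular vectors of the Fock space *)

Section CompleteSymmetric.
Variable K : numFieldType.
Local Notation F := (polyalg K nat).

(* [hsym n] is the coefficient of [z^n] in [exp (sum_s 2 x_s z^s / s)], and
   [hseq n] lists [hsym n, ..., hsym 0]. *)
Fixpoint hseq (n : nat) : seq F :=
  if n is n'.+1 then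
    (2 / n%:R) *: (\sum_(s < n) @px K nat s * (hseq n')`_s) :: hseq n'
  else [:: 1].

Definition hsym (n : int) : F := if n is Posz l then head 0 (hseq l) else 0.

Lemma size_hseq n : size (hseq n) = n.+1.
Proof. by elim: n => //= n ->. Qed.

Lemma nth_hseq n s : (hseq n)`_s = hsym (n%:Z - s%:Z).
Proof.
have [le_sn|lt_ns] := leqP s n; last first.
  rewrite nth_default ?size_hseq //; case E : (n%:Z - s%:Z) => [l|l] //; lia.
elim: s n le_sn => [|s IHs] [|n] // le_sn.
  by rewrite subr0.
by rewrite /= IHs //; congr hsym; lia.
Qed.

Lemma hsym_lt0 n : n < 0 -> hsym n = 0.
Proof. by case: n. Qed.

(** Newton's identity for the power sums [2 x_s]. The range may be any [B >= n] because [hsym]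
    vanishes at negative indices. *)
Lemma hsym_rec (n : int) (B : nat) : n <= B%:Z ->
  n%:~R *: hsym n = 2 *: \sum_(s < B) @px K nat s * hsym (n - s.+1%:Z).
Proof.
case: n => [[|n]|n] le_nB; last 1 first.
- rewrite [hsym (Negz n)]hsym_lt0 // scaler0 big1 ?scaler0 // => s _.
  by rewrite hsym_lt0 ?mulr0 //; lia.
- rewrite scale0r big1 ?scaler0 // => s _.
  by rewrite hsym_lt0 ?mulr0 //; lia.
have -> : B = (n.+1 + (B - n.+1))%N by lia.
rewrite big_split_ord /= [X in _ + X]big1 => [|s _]; last first.
  by rewrite hsym_lt0 ?mulr0 //; lia.
rewrite addr0 scalerA -pmulrn mulrCA divff ?pnatr_eq0 // mulr1; congr (_ *: _).
apply: eq_bigr => s _; rewrite nth_hseq; congr (_ * hsym _); lia.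
Qed.

(** On generating functions, [b_{s+1}] multiplies [H(z)] by [z^{s+1}]. In the induction through
    Newton's identity the derivatives of the variables contribute [s + 1] times the right-hand side,
    those of the [hsym] contribute [n - (s + 1)] times. *)
Lemma pd_hsym s n : (s.+1%:R / 2) *: pd s (hsym n) = hsym (n - s.+1%:Z).
Proof.
have [N] := ubnP (absz n); elim: N n => // N IHN [[|n]|n] lt_nN; last 1 first.
- by rewrite linear0 scaler0 hsym_lt0 //; lia.
- by rewrite /= pd1 scaler0.
have n0 : n.+1%:R != 0 :> K by rewrite pnatr_eq0.
apply: (scalerI n0); rewrite scalerA mulrC -scalerA -pdZ.
rewrite [n.+1%:R *: _](@hsym_rec n.+1%:Z n.+1) // pdZ linear_sum /=.
under eq_bigr => t _ do rewrite pdM pd_x.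
rewrite big_split /= scalerDr scalerDr.
have -> : (s.+1%:R / 2) *: (2 *: \sum_(t < n.+1) (s == t)%:R * hsym (n.+1%:Z - t.+1%:Z))
    = s.+1%:R *: hsym (n.+1%:Z - s.+1%:Z).
  rewrite scalerA divfK ?pnatr_eq0 //; congr (_ *: _).
  have [lt_sn|le_ns] := ltnP s n.+1.
    rewrite (bigD1 (Ordinal lt_sn)) //= eqxx mul1r big1 ?addr0 // => t ts.
    case: eqP => [E|_]; last by rewrite mul0r.
    by case/eqP: ts; apply: val_inj.
  rewrite hsym_lt0 ?big1 // => [t _|]; last by lia.
  by rewrite (gtn_eqF (leq_trans (ltn_ord t) le_ns)) mul0r.
have -> : (s.+1%:R / 2) *: (2 *: \sum_(t < n.+1) @px K nat t * pd s (hsym (n.+1%:Z - t.+1%:Z)))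
    = (n.+1%:Z - s.+1%:Z)%:~R *: hsym (n.+1%:Z - s.+1%:Z).
  rewrite (@hsym_rec _ n.+1); last by lia.
  rewrite scalerA mulrC -scalerA scaler_sumr; congr (_ *: _); apply: eq_bigr => t _.
  rewrite scalerAr IHN; last by have := ltn_ord t; lia.
  by congr (_ * hsym _); lia.
by rewrite -scalerDl intrB -!pmulrn addrC subrK.
Qed.

(** When all variables equal [p], [H(z) = (1 - z)^{-2p}]; this is the recurrence of its
    coefficients. *)
Lemma diagev_hsym (n : nat) :
  n.+1%:R *: diagev (hsym n.+1) = (2 *: 'X + n%:R%:P) * diagev (hsym n).
Proof.
have rec (m : nat) : m%:R *: diagev (hsym m)
    = 2 *: 'X * \sum_(s < m) diagev (hsym (m%:Z - s.+1%:Z)).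
  have /(congr1 (@diagev K nat)) := @hsym_rec m m (lexx _).
  rewrite -pmulrn !linearZ linear_sum /= -scalerAl => ->; congr (_ *: _).
  by rewrite mulr_sumr; apply: eq_bigr => s _; rewrite diagevM diagev_x.
rewrite rec big_ord_recl mulrDr mulrDl; congr (_ * diagev (hsym _) + _); first by rewrite /=; lia.
by rewrite mul_polyC rec; congr (_ * _); apply: eq_bigr => s _.
Qed.

Lemma diagev_hsym0 : diagev (hsym 0) = 1.
Proof. exact: diagev1. Qed.

(** At [p = - c/2], [H(z)] is the polynomial [(1 - z)^c] of degree [c]. *)
Lemma diagev_hsym_gt (c : nat) (n : int) : c%:Z < n ->
  (diagev (hsym n)).[- c%:R / 2] = 0.
Proof.
case: n => // n lt_cn; elim: n lt_cn => // n IHn lt_cn.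
have n0 : n.+1%:R != 0 :> K by rewrite pnatr_eq0.
apply: (mulfI n0); rewrite -hornerZ diagev_hsym mulr0 hornerM.
rewrite hornerD hornerZ hornerX hornerC; have [->|ne] := eqVneq c n.
  by rewrite mulrCA divff ?pnatr_eq0 // mulr1 addNr mul0r.
by rewrite IHn ?mulr0 //; lia.
Qed.

Lemma diagev_hsym_neq0 (c n : nat) : (n <= c)%N ->
  (diagev (hsym n)).[- c%:R / 2] != 0.
Proof.
elim: n => [|n IHn] le_nc; first by rewrite diagev_hsym0 hornerC oner_eq0.
have n0 : n.+1%:R != 0 :> K by rewrite pnatr_eq0.
rewrite -(mulrI_eq0 _ (mulfI n0)) -hornerZ diagev_hsym hornerM.
rewrite mulf_neq0 ?IHn 1?ltnW // hornerD hornerZ hornerX hornerC.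
rewrite mulrCA divff ?pnatr_eq0 // mulr1 addrC subr_eq0 eqr_nat; lia.
Qed.

End CompleteSymmetric.

#[local] Arguments heis : simpl never.

Lemma derivation_prod (A : comNzRingType) (I : eqType) (D : A -> A) (s : seq I)
    (h : I -> A) : D 1 = 0 -> (forall f g, D (f * g) = D f * g + f * D g) ->
  uniq s ->
  D (\prod_(i <- s) h i) = \sum_(i <- s) D (h i) * \prod_(j <- s | j != i) h j.
Proof.
move=> D1 DM; elim: s => [|i s IHs] /=; first by rewrite !big_nil D1.
move=> /andP[is_ us]; rewrite !big_cons DM IHs // eqxx; congr (_ + _).
  congr (_ * _); rewrite [LHS]big_seq [RHS]big_seq_cond; apply: eq_bigl => j.
  by case: eqP => [->|]; rewrite ?andbT // (negPf is_).
rewrite mulr_sumr [LHS]big_seq [RHS]big_seq; apply: eq_bigr => j js.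
rewrite big_cons; case: eqP => [E|_]; last by rewrite mulrCA.
by rewrite E js in is_.
Qed.

Lemma derivation_eigen_prod (A : comNzRingType) (I : Type) (D : A -> A) (s : seq I)
    (Q : pred I) (h c : I -> A) :
    D 1 = 0 -> (forall f g, D (f * g) = D f * g + f * D g) ->
    (forall i, D (h i) = c i * h i) ->
  D (\prod_(i <- s | Q i) h i) = (\sum_(i <- s | Q i) c i) * \prod_(i <- s | Q i) h i.
Proof.
move=> D1 DM Dh; elim: s => [|i s IHs]; first by rewrite !big_nil D1 mul0r.
by rewrite !big_cons; case: ifP => // _; rewrite DM Dh IHs; ring.
Qed.

(** * The modes and [L_n] acting on constant terms *)

Section SymmetricInsertion.
Variables (K : numFieldType) (k : K) (r B : nat).
Local Notation F := (polyalg K nat).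
Local Notation Y := (polyalg K 'I_r).
Implicit Types (g : Y) (m : {cmonom 'I_r}) (i j : 'I_r).

Definition psum (n : nat) : Y := \sum_i px K i ^+ n.

Definition hprod m : F := \prod_i hsym K (B%:Z - (m i)%:Z).

(* With [H z = sum_n hsym n z^n], [insert g] is the constant term of
   [g (z_1, ..., z_r) * prod_i z_i^{-B} H z_i]. *)
Definition insert : Y -> F := mext hprod.
HB.instance Definition _ := GRing.Linear.on insert.

Lemma insertP a g g' : insert (a *: g + g') = a *: insert g + insert g'.
Proof. exact: linearP. Qed.

Lemma insertU m : insert (mono Y m) = hprod m.
Proof. exact: mextU. Qed.

Definition mshift i n m : {cmonom 'I_r} := iter n (mmul (ucm i)) m.

Lemma mshiftE i n m j : mshift i n m j = ((i == j) * n + m j)%N.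
Proof.
elim: n => [|n IHn]; first by rewrite muln0.
by rewrite /= cmM cmU IHn mulnS addnA.
Qed.

Lemma mono_shift i n m : mono Y (mshift i n m) = px K i ^+ n * mono Y m.
Proof.
elim: n => [|n IHn]; first by rewrite mul1r.
by rewrite /= monoM IHn exprS mulrA.
Qed.

Lemma insert_shift i n m : insert (px K i ^+ n * mono Y m)
  = hsym K (B%:Z - (m i)%:Z - n%:Z) * \prod_(j | j != i) hsym K (B%:Z - (m j)%:Z).
Proof.
rewrite -mono_shift insertU /hprod (bigD1 i) //= mshiftE eqxx mul1n.
congr (hsym K _ * _); first by rewrite PoszD opprD addrA addrAC.
by apply: eq_bigr => j ji; rewrite mshiftE eq_sym (negPf ji).
Qed.

Lemma heis_insert (s : nat) g : heis k s.+1%:Z (insert g) = insert (psum s.+1 * g).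
Proof.
move: g; apply: eq_on_mono => [a u v|a u v|m].
- by rewrite insertP linearP.
- by rewrite mulrDr -scalerAr insertP.
rewrite insertU /hprod /heis.
rewrite (@derivation_prod _ _ (@pd K nat s) (index_enum _)); last first.
- exact: index_enum_uniq.
- exact: pdM.
- exact: pd1.
rewrite scaler_sumr /psum mulr_suml linear_sum; apply: eq_bigr => i _ /=.
by rewrite insert_shift scalerAl pd_hsym.
Qed.

(** A total derivative [z_i d/dz_i] has no constant term, and [z H'(z) = 2 (sum_n x_n z^n) H(z)]. On
    monomials this reduces to Newton's identity for the factor of index [i]. *)
Lemma euler_insert i (N : nat) g : (B <= N)%N ->
  2 *: \sum_(s < N) @px K nat s * insert (px K i ^+ s.+1 * g)
  = insert (B%:R *: g - px K i * pd i g).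
Proof.
move=> leBN; move: g; apply: eq_on_mono => [a u v|a u v|m].
- rewrite scalerA mulrC -scalerA -scalerDr; congr (_ *: _).
  rewrite scaler_sumr -big_split; apply: eq_bigr => s _ /=.
  by rewrite mulrDr -scalerAr insertP mulrDr -scalerAr.
- rewrite -insertP; congr insert; rewrite pdP mulrDr -scalerAr.
  by rewrite scalerDr scalerA [_ * a]mulrC -scalerA linB_arr.
rewrite px_pd_mono -scalerBl linearZ /= insertU /hprod (bigD1 i) //= scalerAl.
have -> : B%:R - (m i)%:R = (B%:Z - (m i)%:Z)%:~R :> K by rewrite intrB.
rewrite (@hsym_rec _ _ N); last by lia.
rewrite -scalerAl; congr (_ *: _); rewrite mulr_suml; apply: eq_bigr => s _.
by rewrite insert_shift mulrA.
Qed.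

Definition euler_field (n : nat) g : Y := \sum_i px K i ^+ n.+1 * pd i g.

(* [heis 0] is the scalar [k], so it plays the role of multiplication by [psum 0]. *)
Definition psum_charge (n : nat) : Y := if n is 0 then k *: 1 else psum n.

Lemma heis_insert_nat (n : nat) g : heis k n%:Z (insert g) = insert (psum_charge n * g).
Proof.
case: n => [|n]; last exact: heis_insert.
by rewrite /heis /psum_charge -scalerAl mul1r linearZ.
Qed.

(** The products [b_u b_{n-u}] with [0 <= u <= n] become multiplications. The terms with a creation
    mode are evaluated by [euler_insert] on [z_i^n g]; differentiating [z_i^n] yields the [- n]. *)
Lemma sug_insert (n : nat) g : sug k n%:Z (insert g)
  = insert ((\sum_(u < n.+1) psum_charge u * psum_charge (n - u)
             + (B%:R - n%:R) *: psum n) * g - euler_field n g).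
Proof.
pose N := (fbd k (insert g) + n + B).+1.
rewrite (@sug_pos _ _ _ N); last by rewrite /N; lia.
have -> : \sum_(u < n.+1) heis k u%:Z (heis k (n%:Z - u%:Z) (insert g))
    = insert ((\sum_(u < n.+1) psum_charge u * psum_charge (n - u)) * g).
  rewrite mulr_suml linear_sum; apply: eq_bigr => u _.
  rewrite subzn; last exact: (ltn_ord u).
  by rewrite !heis_insert_nat mulrA.
have -> : 2 *: \sum_(l < N) heis k (Negz l) (heis k (n + l.+1)%N (insert g))
    = \sum_i insert (B%:R *: (px K i ^+ n * g) - px K i * pd i (px K i ^+ n * g)).
  under [RHS]eq_bigr => i _.
    rewrite -(@euler_insert i N); last by rewrite /N; lia.
    over.
  rewrite -scaler_sumr exchange_big /=; congr (_ *: _); apply: eq_bigr => l _.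
  rewrite addnS -mulr_sumr; congr (_ * _).
  rewrite (heis_insert (n + l)) /psum mulr_suml linear_sum; apply: eq_bigr => i _ /=.
  by rewrite mulrA -exprD addSn addnC.
rewrite -linear_sum -linearD /=; congr insert.
rewrite mulrDl -addrA; congr (_ + _).
rewrite /euler_field /psum scaler_sumr mulr_suml -sumrB; apply: eq_bigr => i _.
have pdXn : pd i (px K i ^+ n) = n%:R *: px K i ^+ n.-1.
  elim: n {N} => [|n IHn]; first by rewrite pd1 scale0r.
  rewrite exprS pdM pd_x eqxx mul1r IHn -scalerAr.
  case: n {IHn} => [|n]; first by rewrite scale0r addr0 scale1r.
  by rewrite -exprS -[n.+2%:R]natr1 scalerDl scale1r addrC.
rewrite pdM pdXn mulrDr !mulrA -exprS -scalerAr.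
have -> : n%:R *: (px K i * px K i ^+ n.-1) = n%:R *: px K i ^+ n.
  by case: n {pdXn N} => [|n]; rewrite ?scale0r // -exprS.
by rewrite scalerBl mulrBl opprD addrA -!scalerAl.
Qed.

End SymmetricInsertion.

(** * The squared Vandermonde product and the rectangular vectors *)

Section VandermondeSquare.
Variables (K : numFieldType) (r : nat).
Local Notation Y := (polyalg K 'I_r).
Implicit Types (g : Y) (m : {cmonom 'I_r}) (i j : 'I_r).

Definition vdm : Y := \prod_(i < r) \prod_(j < r | (i < j)%N) ((@px K 'I_r j) - (@px K 'I_r i)).

Lemma euler_field1 n : euler_field n (1 : Y) = 0.
Proof. by rewrite /euler_field big1 // => i _; rewrite pd1 mulr0. Qed.

Lemma euler_fieldM n f g :
  euler_field n (f * g : Y) = euler_field n f * g + f * euler_field n g.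
Proof.
rewrite /euler_field mulr_suml mulr_sumr -big_split; apply: eq_bigr => i _ /=.
by rewrite pdM; ring.
Qed.

Lemma euler_fieldB n f g : euler_field n (f - g : Y) = euler_field n f - euler_field n g.
Proof.
rewrite /euler_field -sumrB; apply: eq_bigr => i _.
by rewrite linearB mulrBr.
Qed.

Lemma euler_field_px n j : euler_field n ((@px K 'I_r j)) = (@px K 'I_r j) ^+ n.+1.
Proof.
rewrite /euler_field (bigD1 j) //= pd_x eqxx mulr1 big1 ?addr0 // => i ij.
by rewrite pd_x (negPf ij) mulr0.
Qed.

(** The quotient of [z_j^{n+1} - z_i^{n+1}] by [z_j - z_i], in a form that also makes sense for
    [i = j]. *)
Definition hsum2 n i j : Y := \sum_(u < n.+1) (@px K 'I_r j) ^+ (n - u) * (@px K 'I_r i) ^+ u.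

Lemma hsum2C n i j : hsum2 n i j = hsum2 n j i.
Proof.
rewrite /hsum2 (reindex_inj rev_ord_inj); apply: eq_bigr => u _ /=.
by rewrite subSS subKn 1?mulrC // -ltnS ltn_ord.
Qed.

Lemma hsum2_diag n i : hsum2 n i i = n.+1%:R *: (@px K 'I_r i) ^+ n.
Proof.
rewrite /hsum2 (eq_bigr (fun=> (@px K 'I_r i) ^+ n)) => [|u _]; last first.
  by rewrite -exprD subnK // -ltnS ltn_ord.
by rewrite sumr_const card_ord scaler_nat.
Qed.

Lemma euler_vdm n : euler_field n vdm = (\sum_(i < r) \sum_(j < r | (i < j)%N) hsum2 n i j) * vdm.
Proof.
apply: derivation_eigen_prod; [exact: euler_field1|exact: euler_fieldM|move=> i].
apply: derivation_eigen_prod; [exact: euler_field1|exact: euler_fieldM|move=> j].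
by rewrite euler_fieldB !euler_field_px subrXX mulrC.
Qed.

Lemma sum_hsum2 n : 2 *: \sum_(i < r) \sum_(j < r | (i < j)%N) hsum2 n i j
  = \sum_(u < n.+1) psum K r u * psum K r (n - u) - n.+1%:R *: psum K r n.
Proof.
have -> : \sum_(u < n.+1) psum K r u * psum K r (n - u) = \sum_(i < r) \sum_(j < r) hsum2 n i j.
  rewrite /psum; under eq_bigr => u _ do rewrite mulr_suml.
  rewrite exchange_big; apply: eq_bigr => i _ /=.
  under eq_bigr => u _ do rewrite mulr_sumr.
  rewrite exchange_big; apply: eq_bigr => j _ /=.
  by apply: eq_bigr => u _; rewrite mulrC.
have -> : n.+1%:R *: psum K r n = \sum_(i < r) hsum2 n i i.
  by rewrite /psum scaler_sumr; apply: eq_bigr => i _; rewrite hsum2_diag.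
have -> : \sum_(i < r) \sum_(j < r) hsum2 n i j = \sum_(i < r) \sum_(j < r | (i < j)%N) hsum2 n i j
    + \sum_(i < r) \sum_(j < r | (j < i)%N) hsum2 n i j + \sum_(i < r) hsum2 n i i.
  rewrite -!big_split; apply: eq_bigr => i _ /=.
  rewrite (bigID (fun j : 'I_r => (i < j)%N)) /= -addrA; congr (_ + _).
  rewrite (bigD1 i) ?ltnn //= addrC; congr (_ + _); apply: eq_bigl => j.
  by rewrite -leqNgt ltn_neqAle andbC.
rewrite addrK scaler_nat mulr2n; congr (_ + _).
rewrite [RHS](exchange_big_dep xpredT) //=; apply: eq_bigr => i _.
by apply: eq_bigr => j _; rewrite hsum2C.
Qed.

Lemma euler_vdm2 n : euler_field n (vdm ^+ 2)
  = (\sum_(u < n.+1) psum K r u * psum K r (n - u) - n.+1%:R *: psum K r n)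
    * vdm ^+ 2.
Proof.
by rewrite -sum_hsum2 expr2 euler_fieldM euler_vdm scaler_nat; ring.
Qed.

Lemma psum0 : psum K r 0 = r%:R.
Proof. by rewrite /psum sumr_const card_ord. Qed.

Section Singular.
Variables (k : K) (c : nat).
Hypothesis kE : 2 * k = r%:R - c%:R.
Local Notation B := (c + r).-1.

(* Up to a non-zero scalar, the Schur function of the [r] by [c] rectangle. *)
Definition rect_vec : polyalg K nat := insert B (vdm ^+ 2).

(** The quadratic power sums cancel against those of [euler_vdm2], except that [b_0] is [k] where
    [psum 0] is [r]. What is left is [psum n] times [2 (k - r) + (B - n) + (n + 1) = 2 k - r + c =
    0]. *)
Lemma sug_rect_vec (n : nat) : (0 < n)%N -> sug k n%:Z rect_vec = 0.
Proof.
case: n => // n _; rewrite sug_insert euler_vdm2 -mulrBl.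
suff -> : \sum_(u < n.+2) psum_charge k r u * psum_charge k r (n.+1 - u)
    + (B%:R - n.+1%:R) *: psum K r n.+1
    - (\sum_(u < n.+2) psum K r u * psum K r (n.+1 - u) - n.+2%:R *: psum K r n.+1)
    = 0 by rewrite mul0r linear0.
have -> : \sum_(u < n.+2) psum_charge k r u * psum_charge k r (n.+1 - u)
    = \sum_(u < n.+2) psum K r u * psum K r (n.+1 - u)
      + (2 * (k - r%:R)) *: psum K r n.+1.
  rewrite [LHS]big_ord_recl big_ord_recr [X in _ = X + _]big_ord_recl big_ord_recr.
  rewrite /= subn0 subnn psum0.
  set p := psum K r n.+1; set S := (X in _ + (X + _) = _).
  set S' := (X in _ = _ + (X + _) + _); have -> : S = S'.
    apply: eq_bigr => u _; rewrite /= /bump leq0n !add1n subSS.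
    by have := ltn_ord u; rewrite -subn_gt0; case: (n - u)%N.
  rewrite !mulr_algl mulr_algr mulr_natl mulr_natr -scaler_nat.
  have -> : 2 * (k - r%:R) = k + k - r%:R - r%:R by ring.
  by rewrite !scalerBl scalerDl; ring.
(* For [r = 0] the predecessor in [B] can be truncated, but then the power sums are empty. *)
have [r0|r0] := eqVneq r 0%N.
  have -> : psum K r n.+1 = 0.
    by rewrite /psum big1 // => i _; have := ltn_ord i; rewrite [X in (_ < X)%N]r0.
  by rewrite !scaler0 subr0 addr0 addr0 subrr.
have -> : (c + r).-1%:R = c%:R + r%:R - 1 :> K.
  by rewrite -subn1 natrB ?natrD //; lia.
have -> : n.+2%:R = - (2 * (k - r%:R) + (c%:R + r%:R - 1 - n.+1%:R)) :> K.
  by rewrite mulrBr kE -[n.+2%:R]natr1; ring.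
by move: (2 * _) (_ - n.+1%:R) => a b; rewrite scaleNr scalerDl; ring.
Qed.

Lemma sug0_rect_vec : sug k 0 rect_vec = (k ^+ 2 + (r * c)%:R) *: rect_vec.
Proof.
rewrite -[0]/(0%N%:Z) sug_insert euler_vdm2 -mulrBl.
rewrite !big_ord1 /= psum0 subr0 scale1r -linearZ /=; congr (insert _ _).
rewrite -[X in _ = _ *: X]mul1r scalerAl; congr (_ * _).
have BE : (c + r).-1%:R * r%:R = (c%:R + r%:R - 1) * r%:R :> K.
  have [->|r0] := eqVneq r 0%N; first by rewrite !mulr0.
  by congr (_ * _); rewrite -subn1 natrB ?natrD //; lia.
have -> : r%:R = r%:R *: 1 :> Y by rewrite scaler_nat.
rewrite -!scalerAl !mul1r !scalerA -expr2 BE.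
rewrite -addrA -!scalerBl -scalerDl; congr (_ *: _).
by rewrite natrM; ring.
Qed.

End Singular.

Lemma coef_sign m (b : bool) g : coef m ((-1) ^+ b * g) = (-1) ^+ b * coef m g.
Proof. by case: b; rewrite ?mulN1r ?mul1r // linearN. Qed.

Lemma mono_prod (e : 'I_r -> nat) : exists m, (forall i, m i = e i)
  /\ \prod_i (@px K 'I_r i) ^+ e i = mono Y m.
Proof.
have [m' [m'E ->]] : exists m', (forall i, m' i = (i \in index_enum 'I_r) * e i)%N
    /\ \prod_(i < r) (@px K 'I_r i) ^+ e i = mono Y m'.
  elim: (index_enum _) (index_enum_uniq 'I_r) => [|i s IHs] /=.
    by exists 1%M; split=> [i|]; rewrite ?cm1 // big_nil mono1.
  move=> /andP[is_ /IHs[m' [m'E sE]]]; exists (mshift i (e i) m'); split=> [j|].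
    rewrite mshiftE m'E inE eq_sym; case: (j =P i) => [->|_] //=.
    by rewrite (negPf is_) addn0.
  by rewrite big_cons sE mono_shift.
by exists m'; split=> // i; rewrite m'E mem_index_enum mul1n.
Qed.

Lemma coef_prod_px m (e : 'I_r -> nat) :
  coef m (\prod_i (@px K 'I_r i) ^+ e i) = [forall i, m i == e i]%:R.
Proof.
have [m' [m'e ->]] := mono_prod e.
rewrite coefU; congr (nat_of_bool _)%:R; apply/eqP/forallP => [<- i|mm'].
  by rewrite m'e.
by apply/eqP/cmP => i; rewrite m'e (eqP (mm' i)).
Qed.

Lemma vdm_det : vdm = \sum_(s : 'S_r) (-1) ^+ s * \prod_i (@px K 'I_r i) ^+ ((s^-1)%g i).
Proof.
have := det_Vandermonde (\row_i @px K 'I_r i).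
under eq_bigr => i _ do under eq_bigr => j _ do rewrite !mxE.
rewrite -/vdm => <-; apply: eq_bigr => s _; congr (_ * _).
rewrite [RHS](reindex_inj (@perm_inj _ s)); apply: eq_bigr => i _.
by rewrite !mxE permK.
Qed.

(** The coefficient is [r!] up to sign. One copy of the determinant is expanded with its exponents
    reversed by [rho]: the permutations [s] and [t] then yield the monomial [m] exactly when
    [s = t], and the signs of the two terms multiply to 1. *)
Lemma coef_vdm2 m : (forall i, m i = r.-1) -> coef m (vdm ^+ 2) != 0.
Proof.
move=> mE; pose rho := perm (@rev_ord_inj r).
have vdm_det' : vdm = (-1) ^+ rho
    * \sum_(s : 'S_r) (-1) ^+ s * \prod_i (@px K 'I_r i) ^+ (rev_ord ((s^-1)%g i)).
  rewrite {1}vdm_det (reindex_inj (mulgI rho)) mulr_sumr; apply: eq_bigr => s _.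
  rewrite odd_permM signr_addb mulrA; congr (_ * _); apply: eq_bigr => i _.
  rewrite invMg permM; congr (_ ^+ _).
  suff -> : (rho^-1 = rho)%g by rewrite permE.
  by apply/permP => j; apply: (@perm_inj _ rho); rewrite permKV !permE rev_ordK.
rewrite expr2 {2}vdm_det' vdm_det mulrCA coef_sign mulf_neq0 ?signr_eq0 //.
rewrite mulr_suml linear_sum /=.
rewrite (eq_bigr (fun=> 1)) ?sumr_const => [|s _].
  by rewrite pnatr_eq0 card_Sn -lt0n fact_gt0.
rewrite mulr_sumr linear_sum (bigD1 s) //= [X in _ + X]big1 => [|t ts].
  rewrite addr0 mulrACA -signr_addb addbb mul1r -big_split /=.
  under eq_bigr => i _ do rewrite -exprD.
  rewrite coef_prod_px (_ : [forall i, _]) //; apply/forallP => i; apply/eqP.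
  by rewrite mE /=; have := ltn_ord ((s^-1)%g i); lia.
rewrite mulrACA -signr_addb -big_split coef_sign /=.
under eq_bigr => i _ do rewrite -exprD.
rewrite coef_prod_px (_ : [forall i, _] = false) ?mulr0 //.
apply: contraNF ts => /forallP E; apply/eqP; apply: invg_inj; apply/permP => i.
apply: val_inj; have /eqP := E i; rewrite mE /=.
by move: ((s^-1)%g i) ((t^-1)%g i) => [a la] [b lb] /=; lia.
Qed.

(** [euler_field 0] multiplies a monomial by its degree, and [vdm ^+ 2] is an eigenvector with
    eigenvalue [r (r - 1)]. *)
Lemma coef_vdm2_deg m : coef m (vdm ^+ 2) != 0 -> (\sum_i m i = r * r.-1)%N.
Proof.
have euler0 g : coef m (euler_field 0 g) = (\sum_i m i)%:R * coef m g.
  rewrite /euler_field linear_sum natr_sum mulr_suml; apply: eq_bigr => i _.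
  move: g; apply: eq_on_mono => [a u v|a u v|m'].
  - by rewrite pdP mulrDr -scalerAr linearP.
  - by rewrite linearP mulrDr; congr (_ + _); apply: mulrCA.
  rewrite expr1 px_pd_mono linearZ /= coefU.
  by case: eqP => [->|_]; rewrite ?mulr0 // scaler0.
have := euler0 (vdm ^+ 2); rewrite euler_vdm2 big_ord1 psum0 scale1r.
have -> : r%:R * r%:R - r%:R = (r * r.-1)%:R :> Y.
  rewrite -natrM -natrB; last by case: (r) => // n; rewrite leq_pmull.
  by congr _%:R; case: (r) => // n; rewrite mulnS addKn.
have -> (n : nat) : coef m (n%:R * vdm ^+ 2) = n%:R * coef m (vdm ^+ 2).
  by rewrite !mulr_natl raddfMn.
move=> E c0.
by have /eqP := mulIf c0 E; rewrite eqr_nat => /eqP.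
Qed.

(* At [- c / 2] the function [hsym n] vanishes for [n > c], so that only the
   monomial of [vdm ^+ 2] with all exponents [r - 1] contributes. *)
Lemma diagev_rect_vec c : (diagev (rect_vec c)).[- c%:R / 2] != 0.
Proof.
pose eta n := (diagev (hsym K n)).[- c%:R / 2].
have [m0 [m0E _]] := mono_prod (fun=> r.-1).
pose phi m := \prod_i eta ((c + r).-1%:Z - (m i)%:Z).
have -> : (diagev (rect_vec c)).[- c%:R / 2] = mext (phi : _ -> K^o) (vdm ^+ 2).
  rewrite /rect_vec; move: (vdm ^+ 2).
  apply: (eq_on_mono (V := K^o)
    (F := fun g => (diagev (insert (c + r).-1 g)).[- c%:R / 2])) => [a u v|a u v|m].
  - by rewrite insertP linearP /= hornerD hornerZ.
  - by rewrite linearP.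
  rewrite insertU mextU /hprod (big_morph (@diagev K nat) (@diagevM K nat) (@diagev1 K nat)).
  by rewrite horner_prod.
have -> : mext (phi : _ -> K^o) (vdm ^+ 2) = coef m0 (vdm ^+ 2) * eta c ^+ r.
  have -> : coef m0 (vdm ^+ 2) * eta c ^+ r
      = mext (fun m => (m == m0)%:R * eta c ^+ r : K^o) (vdm ^+ 2).
    move: (vdm ^+ 2); apply: (eq_on_mono (V := K^o)
      (F := fun g => coef m0 g * eta c ^+ r)) => [a u v|a u v|m].
    + by rewrite linearP mulrDl -[_ *: _]/(_ * _) -mulrA.
    + by rewrite linearP.
    by rewrite coefU mextU.
  have [s [_ sE]] := finite_coef (vdm ^+ 2).
  rewrite !sE; apply: eq_bigr => m _.
  have [->|/coef_vdm2_deg mdeg] := eqVneq (coef m (vdm ^+ 2)) 0; first by rewrite !scale0r.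
  congr (_ *: _); case: eqP => [->|/eqP mm0].
    rewrite mul1r -[X in _ ^+ X]card_ord -prodr_const; apply: eq_bigr => i _.
    by congr eta; rewrite m0E; case: i => i /=; lia.
  rewrite mul0r; suff [i lt_i] : exists i, (m i < r.-1)%N.
    rewrite /phi (bigD1 i) //= [eta _]diagev_hsym_gt ?mul0r //.
    by have := leq_ltn_trans (leq0n i) (ltn_ord i); move: lt_i; move: (m i) => q; lia.
  apply/existsP; apply: contraNT mm0; rewrite negb_exists => /forallP ge_m.
  apply/cmP => i; rewrite m0E; apply/eqP; rewrite eq_sym eqn_leq leqNgt ge_m /=.
  have: (\sum_j (m j - r.-1) = 0)%N.
    rewrite sumnB => [|j _]; last by rewrite leqNgt ge_m.
    by rewrite mdeg sum_nat_const card_ord subnn.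
  by move/eqP; rewrite sum_nat_eq0 => /forallP/(_ i); rewrite subn_eq0.
by rewrite mulf_neq0 ?expf_neq0 ?coef_vdm2 // diagev_hsym_neq0.
Qed.

End VandermondeSquare.

(** * Enveloping algebra actions and density modules *)

Section EnvelopingActions.
Variables (K : numFieldType).

Lemma rep0r (g : lieType K) (M : lmodType K) (rho : lieRep g M) x : rho x 0 = 0.
Proof. by have := rep_linr rho (-1) x 0 0; rewrite scaler0 addr0 scaleN1r addNr. Qed.

Lemma repZ (g : lieType K) (M : lmodType K) (rho : lieRep g M) x a m :
  rho x (a *: m) = a *: rho x m.
Proof. by rewrite -[a *: m]addr0 rep_linr rep0r addr0. Qed.

Lemma uact0r (g : lieType K) (M : lmodType K) (rho : lieRep g M) (u : envel g) :
  uact rho u 0 = 0.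
Proof. exact: tact0. Qed.

Lemma uactZ (g : lieType K) (M : lmodType K) (rho : lieRep g M) a (u : envel g) m :
  uact rho (a *: u) m = a *: uact rho u m.
Proof. by elim/envelP: u => t; rewrite -piZ !uactE. Qed.

Lemma uactD (g : lieType K) (M : lmodType K) (rho : lieRep g M) (u v : envel g) m :
  uact rho (u + v) m = uact rho u m + uact rho v m.
Proof. by rewrite -{1}[u]scale1r uact_linl scale1r. Qed.

Lemma uact0 (g : lieType K) (M : lmodType K) (rho : lieRep g M) m :
  uact rho (0 : envel g) m = 0.
Proof. exact: (uactE _ UZero). Qed.

Lemma uact_envel_map (g g' : lieType K) (M : lmodType K) (f : lieHom g g')
    (rho : lieRep g' M) (u : envel g) m :
  uact rho (envel_map f u) m = uact (rep_pull f rho) u m.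
Proof.
rewrite /envel_map -[in RHS](uact1 rho m); move: (1 : envel g').
elim/envelP: u => t x; rewrite !uactE.
elim: t x => [y|||t IHt u IHu|a t IHt|t IHt u IHu] x /=.
- by rewrite uactM uact_gen.
- by rewrite uact0.
- by [].
- by rewrite uactD IHt IHu.
- by rewrite uactZ IHt.
- by rewrite IHt IHu.
Qed.

Lemma uact_verma (c h : K) u x :
  uact (verma_rep c h) u (verma_pi c h x) = verma_pi c h (u * x).
Proof.
elim/envelP: u => t; rewrite uactE.
elim: t x => [y|||t IHt u IHu|a t IHt|t IHt u IHu] x.
- by rewrite /= verma_mulE.
- transitivity (verma_pi c h 0); first by rewrite /verma_pi raddf0.
  by congr verma_pi; rewrite -[RHS]/(0 * x) mul0r.
- by congr verma_pi; rewrite -[RHS]/(1 * x) mul1r.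
- by rewrite /= IHt IHu piD mulrDl verma_piD.
- by rewrite /= IHt piZ verma_scaleE verma_mulE -scalerAl -scalerAl mul1r.
- by rewrite /= IHu IHt piM mulrA.
Qed.

(** The universal property of the Verma module: whatever vanishes on its generator vanishes on every
    highest weight vector with the same [c] and [h]. *)
Lemma verma_ideal_uact (c h : K) (M : lmodType K) (rho : lieRep (vir K) M) w :
    (forall n, 0 < n -> rho (L n) w = 0) -> rho (L 0) w = h *: w ->
    rho C w = c *: w ->
  forall x, verma_ideal c h x -> uact rho x w = 0.
Proof.
have uactB1 x a v : uact rho (x - a%:A) v = uact rho x v - a *: v.
  by rewrite uactD !uactZ uact1 scaleN1r.
move=> wpos w0 wC x; elim=> {x} [|x y _ IHx _ IHy|u x _ IHx|n n0||].
- by rewrite uact0.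
- by rewrite uactD IHx IHy addr0.
- by rewrite uactM IHx uact0r.
- by rewrite uact_gen wpos.
- by rewrite uactB1 uact_gen w0 subrr.
- by rewrite uactB1 uact_gen wC subrr.
Qed.

End EnvelopingActions.

(** * The action of [L_{-n}] after setting all variables equal *)

Section FockEvaluation.
Variables (K : numFieldType) (k : K).
Local Notation F := (polyalg K nat).
Implicit Types (f w : F).

Lemma diagev_heis_neg (n : nat) f :
  diagev (heis k (- n%:Z) f) = (if n == 0%N then k%:P else 'X) * diagev f.
Proof.
case: n => [|n] /=; first by rewrite /heis oppr0 linearZ /= mul_polyC.
by rewrite -NegzE /heis diagevM diagev_x.
Qed.

(** The terms [x_{n+l} b_l] evaluate alike for every [n], so they can be taken from [L_0]. Only the
    products [b_{-u} b_{u-n}] depend on [n]: they give [2 k p + (n - 1) p^2], in place of [k^2] for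
    [L_0]. *)
Lemma diagev_sug_neg (n : nat) f : (0 < n)%N ->
  diagev (sug k (- n%:Z) f) = diagev (sug k 0 f)
    + ((n%:R - 1) *: 'X^2 + (2 * k) *: 'X - (k ^+ 2)%:P) * diagev f.
Proof.
case: n => // n _; pose N := (fbd k f + n.+1).+1.
rewrite (@sug_neg _ _ _ N) ?ltnSn // -[0 in RHS]/(- 0%N%:Z).
rewrite (@sug_neg _ _ _ N); last by rewrite /N; lia.
have diagD (g h : F) : diagev (g + h) = diagev g + diagev h by apply: linearD.
have diagZ a (g : F) : diagev (a *: g) = a *: diagev g by apply: linearZ.
rewrite !diagD !diagZ.
have -> : diagev (\sum_(l < N) heis k (Negz (n.+1 + l)) (heis k l.+1 f))
    = diagev (\sum_(l < N) heis k (Negz (0 + l)) (heis k l.+1 f)).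
  rewrite !linear_sum; apply: eq_bigr => l _.
  by rewrite [LHS]diagevM [RHS]diagevM !diagev_x.
pose A u : {poly K} := if u == 0%N then k%:P else 'X.
have term (m u : nat) : (u <= m)%N ->
    diagev (heis k (- u%:Z) (heis k (u%:Z - m%:Z) f)) = A u * A (m - u)%N * diagev f.
  move=> le_um; rewrite diagev_heis_neg -[u%:Z - _]opprB subzn // diagev_heis_neg.
  by rewrite mulrA.
have sumA (m : nat) : diagev (\sum_(u < m.+1) heis k (- u%:Z) (heis k (u%:Z - m%:Z) f))
    = (\sum_(u < m.+1) A u * A (m - u)%N) * diagev f.
  by rewrite linear_sum mulr_suml; apply: eq_bigr => u _; apply: (term m u (ltn_ord u)).
rewrite !sumA addrAC; congr (_ + _); rewrite -mulrDl; congr (_ * _).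
rewrite big_ord1 big_ord_recl big_ord_recr /= subn0 subnn /A !eqxx /=.
rewrite (eq_bigr (fun=> 'X^2)) => [|u _]; last first.
  case: eqP => [|_]; last by rewrite expr2.
  by have := ltn_ord u; rewrite /= /bump; lia.
have -> : (n.+1 - bump 0 n)%N = 0%N by rewrite /bump; lia.
have -> : (2 * k) *: 'X = 2 * (k%:P * 'X) :> {poly K}.
  by rewrite -scalerA scaler_nat mul_polyC mulr_natl.
rewrite sumr_const card_ord -scaler_nat -natr1 addrK polyC_exp eqxx.
by ring.
Qed.

Lemma sug0_sug_neg (n : nat) e f : (0 < n)%N -> sug k 0 f = e *: f ->
  sug k 0 (sug k (- n%:Z) f) = (e + n%:R) *: sug k (- n%:Z) f.
Proof.
move=> n0 f0; have := vir_fock k 0 (- n%:Z) f; rewrite f0 sugZ !add0r opprK.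
rewrite oppr_eq0 eqz_nat gtn_eqF // scale0r addr0 => /eqP; rewrite subr_eq => /eqP ->.
by rewrite -scalerDl addrC.
Qed.

End FockEvaluation.

Section DensityAction.
Variables (K : numFieldType).

Lemma density_vec_neq0 n : density_vec n != 0 :> density K.
Proof. by apply/eqP => /malgP/(_ n)/eqP; rewrite mcoeffUU mcoeff0 oner_eq0. Qed.

Lemma density_homogeneous d (u : U1 K) : homogeneous d u ->
  exists a : {poly {poly K}}, forall la mu : K,
    U1_act (density_rep la mu) u (density_vec 0)
    = a.[la%:P].[mu] *: density_vec (- d%:Z).
Proof.
elim=> {d u} [|d|d b u v _ [au IHu] _ [av IHv]|d n x u xE _ [au IHu]].
- by exists 1 => la mu; rewrite /U1_act uact1 !hornerC scale1r.
- by exists 0 => la mu; rewrite U1_act0 !hornerC scale0r.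
- exists (b%:P *: au + av) => la mu; rewrite U1_act_linl IHu IHv.
  by rewrite hornerD hornerZ hornerD hornerM hornerC scalerDl scalerA.
have n0 := lower_gen_gt0 xE.
(* The outer indeterminate stands for [la], the inner one for [mu]; [L_{-n}] sends [v_{-d}] to
   [(d + n la - mu) v_{-d-n}]. *)
exists (((d%:R%:P - 'X)%:P + n%:R%:P *: 'X) * au) => la mu.
rewrite U1_act_gen xE IHu repZ.
rewrite density_repL scalerA; congr (_ *: density_vec _); last by lia.
rewrite hornerM hornerM mulrC; congr (_ * _).
rewrite !hornerE /= !mulrNz -!pmulrn; ring.
Qed.

(** On a vector of energy [e + d], [L_{-n}] multiplies the value at [p] by
    [e + d + (n - 1) p^2 + 2 k p - k^2]. With this [mu] that is [d + n p^2 - mu], the coefficient in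
    the density module. The induction has to carry the energy along. *)
Lemma fock_density_homogeneous (k p e : K) d (u : U1 K) (w : polyalg K nat) :
    homogeneous d u -> sug k 0 w = e *: w ->
  exists s : K, [/\ U1_act (density_rep (p ^+ 2) ((k - p) ^+ 2 - e)) u (density_vec 0)
      = s *: density_vec (- d%:Z),
    (diagev (U1_act (fock_rep k) u w)).[p] = s * (diagev w).[p]
    & sug k 0 (U1_act (fock_rep k) u w) = (e + d%:R) *: U1_act (fock_rep k) u w].
Proof.
set mu := _ - e; move=> hu w0.
elim: hu => {d u} [|d|d b u v _ [s [s1 s2 s3]] _ [t [t1 t2 t3]]|d n x u xE _ [s [s1 s2 s3]]].
- by exists 1; rewrite /U1_act !uact1 scale1r mul1r addr0.
- by exists 0; rewrite !U1_act0 linear0 hornerC mul0r scale0r sug0 scaler0.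
- exists (b * s + t); rewrite !U1_act_linl s1 t1; split.
  + by rewrite scalerDl scalerA.
  + by rewrite linearP hornerD hornerZ s2 t2; ring.
  by rewrite sug_linear s3 t3 scalerDr !scalerA mulrC.
have n0 := lower_gen_gt0 xE.
exists ((d%:R + n%:R * p ^+ 2 - mu) * s); rewrite !U1_act_gen xE s1.
have fE : fock_rep k (L (- n%:Z)) (U1_act (fock_rep k) u w)
    = sug k (- n%:Z) (U1_act (fock_rep k) u w) by apply: fock_actL.
split.
- rewrite repZ.
  rewrite density_repL scalerA; congr (_ *: density_vec _); last by lia.
  rewrite mulrC !mulrNz -!pmulrn; ring.
- rewrite fE diagev_sug_neg // s3 linearZ hornerD hornerZ hornerM s2 /mu.
  by rewrite !(hornerD, hornerN, hornerZ, hornerXn, hornerX, hornerC); ring.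
by rewrite fE (sug0_sug_neg n0 s3) natrD addrA addrAC.
Qed.

End DensityAction.

Lemma fock_singular_eq0 (K : numClosedFieldType) (j k : K) d (P : U1 K)
    (w : polyalg K nat) :
    k^* = k -> (0 < d)%N -> normalized_singular_element j d P ->
    (forall n : nat, (0 < n)%N -> sug k n w = 0) -> sug k 0 w = j ^+ 2 *: w ->
  U1_act (fock_rep k) P w = 0.
Proof.
move=> k_real d0 [hom _ [_ _ sing]] w_pos w_0.
have w_gt0 n : 0 < n -> fock_rep k (L n) w = 0.
  by case: n => // n n0; rewrite /= fock_actL w_pos.
have Pw_pos (n : nat) : (0 < n)%N -> sug k n (U1_act (fock_rep k) P w) = 0.
  move=> n0; rewrite -fock_actL -[fock_act _ _ _]/(fock_rep k (L n%:Z) _).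
  (* [L_n P v = 0] in the Verma module means that [L_n P] lies in the defining left ideal, which
     annihilates [w] as well. *)
  have := sing n n0; rewrite /U1_act -!uact_envel_map -!uact_gen -!uactM.
  rewrite uact_verma -[0](raddf0 (verma_pi 1 (j ^+ 2))) => /verma_piP.
  rewrite subr0 mulr1; apply: verma_ideal_uact => //.
  - by rewrite /= fock_actL.
  - by rewrite /= fock_actC scale1r.
apply: form_eq0; exact: (form_homogeneous k_real _ d0 hom Pw_pos).
Qed.

(** * Degree and leading coefficient in [mu] *)

Section MuDegree.
Variables (K : numFieldType) (la : K).
Local Notation D := (density K).
Implicit Types (F G : K -> D) (v : D) (i : int).

Lemma density_repU mu (t : option int) v :
  density_rep la mu << t >> v = lext (density_basis la mu t) v.
Proof. by rewrite /= /density_act /bilext lextU. Qed.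

Lemma density_rep_sum mu (x : vir K) v : density_rep la mu x v
  = \sum_(t <- msupp x) x@_t *: density_rep la mu << t >> v.
Proof. by apply: eq_bigr => t _; rewrite density_repU. Qed.

Lemma coef_density mu n v i : (density_rep la mu (L n) v)@_i
  = - ((i - n)%:~R + la * n%:~R + mu) * v@_(i - n).
Proof.
move: v; apply: (lin_ext (V := K^o)) => [a u v|a u v|l].
- by rewrite rep_linr mcoeffD mcoeffZ.
- by rewrite mcoeffD mcoeffZ mulrDr; congr (_ + _); apply: mulrCA.
rewrite density_repL /density_vec mcoeffZ !mcoeffU; have [<-|ne] := eqVneq (l + n) i.
  by rewrite addrK eqxx.
have -> : (l == i - n) = false by apply: contraNF ne => /eqP ->; rewrite subrK.
by rewrite !mulr0.
Qed.

(* An element of degree [e] of [U2] raises the degree in [mu] by at most [e / 2]: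
   hence this bound on the degree of the coefficients. *)
Definition mu_family (kap : int) F := forall i, exists q : {poly K},
  (forall mu, (F mu)@_i = q.[mu]) /\
  (forall n : nat, q`_n != 0 -> n%:Z + n%:Z <= kap - i).

Lemma mu_family0 kap : mu_family kap (fun=> 0).
Proof.
move=> i; exists 0; split=> [mu|n]; first by rewrite mcoeff0 horner0.
by rewrite coef0 eqxx.
Qed.

Lemma mu_family_lin kap a F G : mu_family kap F -> mu_family kap G ->
  mu_family kap (fun mu => a *: F mu + G mu).
Proof.
move=> famF famG i; have [q [Fq qP]] := famF i; have [q' [Gq q'P]] := famG i.
exists (a *: q + q'); split=> [mu|n].
  by rewrite mcoeffD mcoeffZ Fq Gq hornerD hornerZ.
rewrite coefD coefZ; have [qn|/qP //] := eqVneq q`_n 0.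
by rewrite qn mulr0 add0r; apply: q'P.
Qed.

(** [L_{-m}] raises the degree in [mu] by at most 1 and lowers the index by [m >= 2], so the same
    [kap] still works. For [m = 1] this argument fails, whence the separate treatment of the powers
    of [L_{-1}]. *)
Lemma mu_family_L kap F (m : nat) : (1 < m)%N -> mu_family kap F ->
  mu_family kap (fun mu => density_rep la mu (L (- m%:Z)) (F mu)).
Proof.
move=> m1 famF i; have [q [Fq qP]] := famF (i + m%:Z).
exists ((la * m%:R - (i + m%:Z)%:~R)%:P * q - 'X * q); split=> [mu|n].
  rewrite coef_density opprK Fq mulrNz -pmulrn.
  by rewrite hornerD hornerN !hornerM hornerX hornerC; ring.
rewrite coefB coefCM coefXM; case: n => [|n].
  rewrite subr0 => q0; have /qP : q`_0 != 0 by apply: contraNneq q0 => ->; rewrite mulr0.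
  lia.
have [qn|/qP] := eqVneq q`_n.+1 0; last by lia.
have [qn'|/qP] := eqVneq q`_n 0; last by lia.
by rewrite /= qn qn' mulr0 subrr eqxx.
Qed.

Lemma mu_family_ext kap F G : (forall mu, F mu = G mu) ->
  mu_family kap F -> mu_family kap G.
Proof.
by move=> FG famF i; have [q [Fq qP]] := famF i; exists q; split=> // mu; rewrite -FG.
Qed.

Lemma mu_family_lower kap F (x : lower K 1) : mu_family kap F ->
  mu_family kap (fun mu => density_rep la mu (lower_val x) (F mu)).
Proof.
move=> famF; pose G mu s := \sum_(t <- s) (lower_val x)@_t *: density_rep la mu << t >> (F mu).
apply: (@mu_family_ext _ (fun mu => G mu (enum_fset (msupp (lower_val x))))) => [mu|].
  by rewrite density_rep_sum.
have : forall t, t \in enum_fset (msupp (lower_val x)) ->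
    if t is Some n then n < - 1%N%:Z else false.
  by case: x {G} => x /= /allP sx t /sx.
elim: (enum_fset _) => [|t s IHs] ts.
  by apply: mu_family_ext (mu_family0 kap) => mu; rewrite /G big_nil.
apply: (@mu_family_ext _ (fun mu =>
    (lower_val x)@_t *: density_rep la mu << t >> (F mu) + G mu s)) => [mu|].
  by rewrite /G big_cons.
apply: mu_family_lin; last by apply: IHs => t' t's; apply: ts; rewrite inE t's orbT.
have := ts t (mem_head _ _); case: t {ts} => // n n1.
have -> : << Some n >> = L (- (absz n)%:Z) :> vir K by rewrite /L; congr << Some _ >>; lia.
by apply: mu_family_L => //; lia.
Qed.

Definition U2_rep mu : lieRep (lower K 1) D :=
  rep_pull (LieHom (@lower21_lin K) (@lower21_lie K))
    (rep_pull (lower_incl K 0) (density_rep la mu)).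

Lemma U1_act_U2_incl mu (q : U2 K) u v :
  U1_act (density_rep la mu) (U2_incl q * u) v
  = uact (U2_rep mu) q (U1_act (density_rep la mu) u v).
Proof. by rewrite /U1_act uactM /U2_incl uact_envel_map. Qed.

Lemma mu_family_U2 kap F (q : U2 K) : mu_family kap F ->
  mu_family kap (fun mu => uact (U2_rep mu) q (F mu)).
Proof.
elim/envelP: q => t famF.
apply: (@mu_family_ext _ (fun mu => tact (U2_rep mu) t (F mu))) => [mu|].
  by rewrite uactE.
elim: t F famF => [x|||t IHt u IHu|a t IHt|t IHt u IHu] F famF.
- exact: mu_family_lower.
- exact: mu_family0.
- exact: famF.
- apply: mu_family_ext (mu_family_lin 1 (IHt _ famF) (IHu _ famF)) => mu.
  by rewrite scale1r.
- apply: mu_family_ext (mu_family_lin a (IHt _ famF) (mu_family0 kap)) => mu.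
  by rewrite addr0.
exact: (IHt _ (IHu _ famF)).
Qed.

Definition Lm1_poly (m : nat) : {poly K} :=
  (-1) ^+ m *: \prod_(i < m) ('X - (i%:R + la)%:P).

Lemma density_Lm1 mu (m : nat) :
  U1_act (density_rep la mu) (ugen (Lm1 K) ^+ m) (density_vec 0)
  = (Lm1_poly m).[mu] *: density_vec (- m%:Z).
Proof.
elim: m => [|m IHm].
  by rewrite /Lm1_poly big_ord0 expr0 /U1_act uact1 hornerZ hornerC mul1r scale1r.
rewrite exprS U1_act_gen IHm repZ [lower_val _]/= density_repL scalerA.
congr (_ *: density_vec _); last by lia.
rewrite /Lm1_poly big_ord_recr /= !hornerZ hornerM hornerXsubC exprS !mulrNz -!pmulrn.
by rewrite mulr1n; ring.
Qed.

Lemma size_Lm1_poly m : size (Lm1_poly m) = m.+1.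
Proof.
by rewrite /Lm1_poly size_scale ?signr_eq0 // size_prod_XsubC /index_enum -enumT size_enum_ord.
Qed.

Lemma lead_Lm1_poly m : (Lm1_poly m)`_m = (-1) ^+ m.
Proof.
have := lead_coefE (Lm1_poly m); rewrite size_Lm1_poly /= => <-.
by rewrite lead_coefZ (monicP (monic_prod_XsubC _ _ _)) mulr1.
Qed.

(** The value [kap = m] is tight: at index [- m] the degree [m] satisfies [m + m = m - (- m)]. *)
Lemma mu_family_Lm1 (m : nat) : mu_family m
  (fun mu => U1_act (density_rep la mu) (ugen (Lm1 K) ^+ m) (density_vec 0)).
Proof.
move=> i; exists (if i == - m%:Z then Lm1_poly m else 0); split=> [mu|n].
  rewrite density_Lm1 /density_vec mcoeffZ mcoeffU eq_sym.
  by case: eqP => _; rewrite ?mulr1 // mulr0 horner0.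
have [->|_] := eqVneq i (- m%:Z); last by rewrite coef0 eqxx.
have [le_nm _|lt_mn] := leqP n m; first by lia.
by rewrite nth_default ?eqxx // size_Lm1_poly.
Qed.

(** At index [- d] the term of [L_{-1}^m] has degree at most [(m + d) / 2], which is below [d] for
    [m < d]; only [L_{-1}^d] reaches degree [d]. As the bound looks at the index alone, it applies
    to any [q m], homogeneous or not. *)
Lemma density_leading d (P : U1 K) (q : nat -> U2 K) :
    P = \sum_(m < d.+1) U2_incl (q m) * ugen (Lm1 K) ^+ m -> q d = 1 ->
  exists b : {poly K}, [/\ forall mu,
      (U1_act (density_rep la mu) P (density_vec 0))@_(- d%:Z) = b.[mu],
    b`_d = (-1) ^+ d & forall n : nat, (d < n)%N -> b`_n = 0].
Proof.
move=> PE qd; pose Q m := U2_incl (q m) * ugen (Lm1 K) ^+ m.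
have [b' [b'E b'P]] : exists b' : {poly K}, (forall mu,
    (U1_act (density_rep la mu) (\sum_(m < d) Q m) (density_vec 0))@_(- d%:Z) = b'.[mu])
    /\ forall n : nat, (d <= n)%N -> b'`_n = 0.
  suff low : forall c, (c <= d)%N -> exists b' : {poly K}, (forall mu,
      (U1_act (density_rep la mu) (\sum_(m < c) Q m) (density_vec 0))@_(- d%:Z) = b'.[mu])
      /\ forall n : nat, (d <= n)%N -> b'`_n = 0 by apply: low.
  elim=> [|m IHm] lt_md.
    exists 0; split=> [mu|n _]; last by rewrite coef0.
    by rewrite big_ord0 U1_act0 mcoeff0 horner0.
  have [b' [b'E b'P]] := IHm (ltnW lt_md).
  have [b'' [b''E b''P]] := mu_family_U2 (q m) (@mu_family_Lm1 m) (- d%:Z).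
  exists (b'' + b'); split=> [mu|n le_dn].
    rewrite big_ord_recr /= addrC -[Q m]scale1r U1_act_linl scale1r mcoeffD b'E.
    by rewrite U1_act_U2_incl b''E hornerD.
  rewrite coefD b'P // addr0; apply/eqP; apply: contraTT le_dn => /b''P; lia.
exists (Lm1_poly d + b'); split=> [mu||n lt_dn].
- rewrite PE big_ord_recr /= qd -/(Q _) addrC -[U2_incl 1 * _]scale1r U1_act_linl.
  rewrite scale1r mcoeffD hornerD -b'E; congr (_ + _).
  rewrite U1_act_U2_incl uact1 density_Lm1 /density_vec mcoeffZ mcoeffUU mulr1 //.
- by rewrite coefD lead_Lm1_poly b'P ?addr0.
by rewrite coefD b'P 1?ltnW // nth_default ?addr0 // size_Lm1_poly.
Qed.

End MuDegree.

(** * The product formula *)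

Lemma poly_natr_eq0 (K : numFieldType) (q : {poly K}) (N : nat) :
  (forall m : nat, (N < m)%N -> q.[m%:R] = 0) -> q = 0.
Proof.
move=> q0; apply/eqP; apply: contraT => /max_poly_roots roots.
have := roots [seq m%:R | m <- iota N.+1 (size q)].
rewrite size_map size_iota ltnn => -> //.
  by apply/allP => _ /mapP[m + ->]; rewrite mem_iota => /andP[lt_Nm _]; apply/eqP/q0.
rewrite map_inj_uniq ?iota_uniq // => m m' /eqP; by rewrite eqr_nat => /eqP.
Qed.

Lemma prod_spins_opp (K : numFieldType) (n : nat) (f : K -> K) :
  \prod_(k <- spins (n%:R / 2) n.+1) f (- k) = \prod_(k <- spins (n%:R / 2) n.+1) f k.
Proof.
rewrite /spins !big_map -[n.+1]subn0 -/(index_iota 0 n.+1) big_nat_rev /=.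
rewrite [LHS]big_nat [RHS]big_nat; apply: eq_bigr => i /andP[_ lt_in].
by congr f; rewrite add0n subSS natrB //; field.
Qed.

Section DensityProduct.
Variables (K : numClosedFieldType) (n : nat) (P : U1 K).
Local Notation j := (n%:R / 2 : K).
Local Notation d := n.+1.
Hypothesis hP : normalized_singular_element j d P.
Variable a : {poly {poly K}}.
Hypothesis aE : forall la mu : K, U1_act (density_rep la mu) P (density_vec 0)
  = a.[la%:P].[mu] *: density_vec (- d%:Z).

Definition spin (r : nat) : K := - j + r%:R.

Definition spin_vec (r : nat) : polyalg K nat := rect_vec K r (n - r).

Lemma density_root r (p : K) : (r < d)%N -> (diagev (spin_vec r)).[p] != 0 ->
  a.[(p ^+ 2)%:P].[(spin r - p) ^+ 2 - j ^+ 2] = 0.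
Proof.
move=> lt_rd w0; pose k := spin r.
have kE : 2 * k = r%:R - (n - r)%:R.
  by rewrite natrB // /k /spin; field.
have k_real : k^* = k.
  by rewrite /k /spin rmorphD rmorphN fmorph_div !rmorph_nat.
have w_pos m : (0 < m)%N -> sug k m%:Z (spin_vec r) = 0 by apply: sug_rect_vec.
have w_0 : sug k 0 (spin_vec r) = j ^+ 2 *: spin_vec r.
  rewrite sug0_rect_vec //; congr (_ *: _).
  by rewrite natrM natrB // /k /spin; field.
have Pw := fock_singular_eq0 k_real (ltn0Sn n) hP w_pos w_0.
have [hom _ _] := hP.
have [s [s1 s2 _]] := fock_density_homogeneous p hom w_0.
have s0 : s = 0.
  by move/eqP: s2; rewrite Pw linear0 hornerC eq_sym mulf_eq0 (negPf w0) orbF => /eqP.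
have /eqP := aE (p ^+ 2) ((k - p) ^+ 2 - j ^+ 2); rewrite s1 s0 scale0r eq_sym.
by rewrite scaler_eq0 (negPf (density_vec_neq0 _ _)) orbF => /eqP.
Qed.

Lemma density_product_generic (p mu : K) :
    (forall r, (r < d)%N -> (diagev (spin_vec r)).[p] != 0) ->
    (forall r r', (r < d)%N -> (r' < d)%N -> (spin r - p) ^+ 2 = (spin r' - p) ^+ 2 -> r = r') ->
  a.[(p ^+ 2)%:P].[mu] = (-1) ^+ d * \prod_(k <- spins j d) (mu + j ^+ 2 - (k - p) ^+ 2).
Proof.
move=> w0 spin_inj; set b := a.[_].
have [_ [q [PE qd]] _] := hP.
have [b' [b'E b'd b'n]] := density_leading (p ^+ 2) PE qd.
have bE : b = b'.
  apply/eqP; rewrite -subr_eq0; apply/eqP/(@poly_natr_eq0 _ _ 0) => m _.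
  by rewrite hornerD hornerN -b'E aE mcoeffZ mcoeffUU mulr1 subrr.
have size_b : size b = d.+1.
  apply/eqP; rewrite eqn_leq bE; apply/andP; split; first exact/leq_sizeP.
  by rewrite ltnNge; apply/negP => /leq_sizeP/(_ d (leqnn _))/eqP; rewrite b'd signr_eq0.
pose rs := [seq (k - p) ^+ 2 - j ^+ 2 | k <- spins j d].
have rsE : rs = [seq (spin r - p) ^+ 2 - j ^+ 2 | r <- iota 0 d].
  by rewrite /rs /spins -map_comp.
have -> : b = lead_coef b *: \prod_(z <- rs) ('X - z%:P).
  apply: all_roots_prod_XsubC.
  - by rewrite size_b rsE size_map size_iota.
  - rewrite rsE; apply/allP => _ /mapP[r + ->]; rewrite mem_iota => /andP[_ lt_rd].
    by apply/eqP/density_root => //; apply: w0.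
  rewrite uniq_rootsE rsE map_inj_in_uniq ?iota_uniq // => r r'.
  rewrite !mem_iota !add0n => /andP[_ lt_rd] /andP[_ lt_rd'] /addIr.
  exact: spin_inj.
rewrite lead_coefE size_b /= bE b'd hornerZ horner_prod big_map; congr (_ * _).
by apply: eq_bigr => k _; rewrite hornerXsubC opprB addrA addrAC.
Qed.

Lemma density_product (p mu : K) :
  a.[(p ^+ 2)%:P].[mu] = (-1) ^+ d * \prod_(k <- spins j d) (mu + j ^+ 2 - (k - p) ^+ 2).
Proof.
pose A : {poly K} := map_poly (horner_eval mu) a \Po 'X^2.
pose Q : {poly K} := (-1) ^+ d *: \prod_(k <- spins j d) ((mu + j ^+ 2)%:P - (k%:P - 'X) ^+ 2).
have AE x : A.[x] = a.[(x ^+ 2)%:P].[mu].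
  rewrite horner_comp hornerXn -[x ^+ 2 in LHS](hornerC (x ^+ 2) mu).
  by rewrite -[_.[mu]]/(horner_eval mu _) horner_map.
have QE x : Q.[x] = (-1) ^+ d * \prod_(k <- spins j d) (mu + j ^+ 2 - (k - x) ^+ 2).
  rewrite hornerZ horner_prod; congr (_ * _); apply: eq_bigr => k _.
  by rewrite hornerD hornerC hornerN horner_exp hornerD hornerN hornerX hornerC.
rewrite -AE -QE; congr (_.[_]); apply/eqP; rewrite -subr_eq0; apply/eqP.
(* The factor [W] absorbs the [p] at which some [spin_vec] vanishes: [W * (A - Q)] is zero at every
   integer [m > n]. *)
pose W := \prod_(r < d) diagev (spin_vec r).
have W0 : W != 0.
  apply/prodf_neq0 => r _; apply/negP => /eqP w0.
  by have := diagev_rect_vec K r (n - r); rewrite -/(spin_vec r) w0 hornerC eqxx.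
apply: (mulIf W0); rewrite mul0r; apply: (@poly_natr_eq0 _ _ n) => m lt_nm.
rewrite hornerM; have [->|Wm] := eqVneq W.[m%:R] 0; first by rewrite mulr0.
rewrite hornerD hornerN AE QE density_product_generic ?subrr ?mul0r //.
  move=> r lt_rd; move: Wm; rewrite horner_prod => /prodf_neq0/(_ (Ordinal lt_rd) isT).
  by [].
move=> r r' lt_rd lt_rd' /eqP; rewrite -subr_eq0 subr_sqr mulf_eq0 => /orP[].
  by rewrite /spin opprD addrACA subrr addr0 opprD addrACA subrr add0r subr_eq0 eqr_nat => /eqP.
(* This factor vanishes only if [r + r' = n + 2 m], which [r, r' <= n < m] excludes. *)
have -> : spin r - m%:R + (spin r' - m%:R) = (r + r')%:R - (n + m + m)%:R.
  by rewrite /spin !natrD; field.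
rewrite subr_eq0 eqr_nat; lia.
Qed.

End DensityProduct.

Local Open Scope complex_scope.

Theorem mainTheorem4 (R : realType) (j : R[i]) (n d : nat)
    (hj : j = n%:R / 2) (hd : d%:R = 2 * j + 1)
    (P : U1 R[i]) (hP : normalized_singular_element j d P) :
  exists a : {poly {poly R[i]}},
    let ev (la mu : R[i]) : R[i] := a.[la%:P].[mu] in
    (forall la mu : R[i],
       U1_act (density_rep la mu) P (density_vec 0)
       = ev la mu *: density_vec (- d%:Z)) /\
    [/\ forall mu : R[i],
          ev 0 mu = (-1) ^+ d *
            \prod_(k <- spins j d) (mu + j ^+ 2 - k ^+ 2),
        forall mu : R[i],
          ev 1 mu = (-1) ^+ d *
            \prod_(k <- spins j d) (mu + j ^+ 2 - (k + 1) ^+ 2),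
        forall (p : R) (mu : R[i]), 0 <= p ->
          ev (p%:C ^+ 2) mu = (-1) ^+ d *
            \prod_(k <- spins j d) (mu + j ^+ 2 - (k + p%:C) ^+ 2)
      & forall la mu : R[i],
          ev la mu ^+ 2 =
            \prod_(k <- spins j d)
              ((la - mu - j ^+ 2 + k ^+ 2) ^+ 2 - 4 * la * k ^+ 2)].
Proof.
have dE : d = n.+1.
  by apply/eqP; rewrite -(eqr_nat R[i]) hd hj -natr1; apply/eqP; field.
subst j d; have [hom _ _] := hP.
have [a aE] := density_homogeneous hom.
have evM p mu := density_product hP aE p mu.
have evP p mu : a.[(p ^+ 2)%:P].[mu] = (-1) ^+ n.+1 *
    \prod_(k <- spins (n%:R / 2) n.+1) (mu + (n%:R / 2) ^+ 2 - (k + p) ^+ 2).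
  rewrite evM -[in LHS]prod_spins_opp; congr (_ * _); apply: eq_bigr => k _.
  by rewrite -opprD sqrrN.
exists a => ev; split; first exact: aE.
split=> [mu|mu|p mu _|la mu].
- have := evP 0 mu; rewrite expr0n /ev => ->; congr (_ * _).
  by apply: eq_bigr => k _; rewrite addr0.
- by have := evP 1 mu; rewrite expr1n.
- exact: evP.
(* With [p] a square root of [la] and [x = mu + j^2], the forms with [k + p] and [k - p] are
   multiplied factor by factor: [(x - (k + p)^2) (x - (k - p)^2) = (x - k^2 - p^2)^2 - 4 p^2
   k^2]. *)
rewrite /ev -[la]sqrtCK expr2 {1}evP evM mulrACA -expr2 sqrr_sign mul1r -big_split.
by apply: eq_bigr => k _ /=; ring.
Qed.
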